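(* For each odd prime $p$, there are, up to isomorphism, exactly $16$ nonassociative extra loops of order $16p$.
   Context: A loop is a set with a binary operation having a two-sided identity $1$ and such that for all $a,b$ the equations $ax=b$ and $ya=b$ have unique solutions. In products, juxtaposition binds more tightly than $\cdot$. An extra loop is a loop that is both conjugacy closed and Moufang; equivalently (and this may be taken as the definition) a loop satisfying the identity $(xy\cdot z)\cdot x = x\cdot(y\cdot zx)$. *)

(* Defs.v *)
From HB Require Import structures.
From mathcomp Require Import all_boot.

Set Implicit Arguments.
Unset Strict Implicit.
Unset Printing Implicit Defensive.

Import Algebra.
Local Open Scope group_scope.

HB.mixin Record UMagma_isLoop G of UMagma G := {
  ldivg_unique : forall a b : G, exists! x : G, a * x = b;
  rdivg_unique : forall a b : G, exists! y : G, y * a = b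
}.

#[short(type="loopType")]
HB.structure Definition Loop := {G of UMagma_isLoop G & UMagma G}.

#[short(type="finLoopType")]
HB.structure Definition FinLoop := {G of Loop G & Finite G}.

(* This identity is equivalent to being both Moufang and conjugacy closed. *)
Definition extra_loop (G : loopType) : Prop :=
  forall x y z : G, ((x * y) * z) * x = x * (y * (z * x)).

Definition nonassociative (G : loopType) : Prop :=
  ~ associative (@mul G).

Definition isomorphic_loops (G H : loopType) : Prop :=
  exists f : {multiplicative G -> H}, bijective f.

(* Main.v *)
Require Import Defs.
From HB Require Import structures.
From mathcomp Require Import all_boot ssralg zmodp fingroup cyclic pgroup.

(** Write [L(x,y)] for the inner mapping taking [z] to [(xy)^-1 (x (yz))], and
    [N] for the nucleus of the loop [Q].

    In an extra loop left translation by [x] extends to the autotopism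
    [x (yz) = (x y x^-1) (xz)].  Comparing the autotopisms of [x], [y] and [xy]
    shows that [L(x,y)] is an automorphism ([inner_mul]).  Squares are nuclear
    ([nucl_sq]), and from this it follows that [L(x,y)] only depends on [x] and [y]
    modulo [N] and fixes [N] pointwise.  Comparing left with right translations
    shows that commutators are nuclear ([commutator_nucl]).  Hence [L(x,y)] is
    symmetric in [x], [y] and is its own inverse, [Q] modulo [N] is a commutative
    Moufang loop of exponent two, which is automatically a group, and
    [L(x,y) z = z a] with [a] in [N], of square one and central in [N].

    Suppose now that [Q] is not associative and has order [16p].  The fixed loops
    of three inner mappings, intersected one after another, form a strictly
    decreasing chain above [N], so that the index of [N] is [2^k] with [k >= 3]; the
    order of [N] is even because of the associators; therefore [#|N| = 2p]
    ([card_nucleus]).  As an associator is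
    central in [N], [N] is the product of a group [{1, e}] and a cyclic group
    generated by some [c] of order [p].  The element [e] is the only involution of
    [N], hence it is central in [Q] and every associator is [1] or [e].  Read as a
    bit, the associator is a symmetric trilinear form on [Q/N], a space of
    dimension three over the field with two elements, and it vanishes when two
    arguments coincide: it is the determinant.

    Each element of [Q] either centralizes or inverts [c].  One can lift a basis of
    [Q/N] to [x], [y], [z] with squares in [{1, e}] and such that [y] and [z]
    centralize [c]; then the commutators of these elements lie in [{1, e}] too
    ([frame_exists]).  The three squares, the three commutators and the action of
    [x] on [c] are seven bits, and they determine the multiplication
    ([model_iso_of_frame]); conversely all seven bits can be prescribed
    ([extra_model]).

    It remains to count these loops up to isomorphism.  Squaring gives a cubic form
    on [Q/N] with leading term [u1 u2 u3], which is the same as a set of points of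
    the Fano plane of odd size; the action on [c] gives a linear form.  Two models
    are isomorphic exactly when a linear map carries one pair of forms to the other.
    There are 5 orbits in which the linear form is zero (a point, a line, three
    independent points, five points, the whole plane), and such sets together with a
    line give 11 more. *)

Set Implicit Arguments.
Unset Strict Implicit.
Unset Printing Implicit Defensive.

Import Algebra.
Local Open Scope group_scope.

(** * Right inverses in a loop *)

Section LoopInverse.

Variable Q : loopType.
Implicit Types x y z : Q.

Lemma loop_rinv_exists x : exists y, x * y == 1.
Proof. by have [y [xy _]] := ldivg_unique x 1; exists y; apply/eqP. Qed.

Definition loopV x : Q := xchoose (loop_rinv_exists x).

Lemma loopV_rinv x : x * loopV x = 1.
Proof. exact/eqP/(xchooseP (loop_rinv_exists x)). Qed.

Lemma loop_mulgI x y z : x * y = x * z -> y = z.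
Proof.
by move=> e; have [w [_ uw]] := ldivg_unique x (x * z); rewrite -(uw z) // -(uw y).
Qed.

Lemma loop_mulIg x y z : y * x = z * x -> y = z.
Proof.
by move=> e; have [w [_ uw]] := rdivg_unique x (z * x); rewrite -(uw z) // -(uw y).
Qed.

Lemma loop_divr x y : exists z, z * x = y.
Proof. by have [z [zx _]] := rdivg_unique x y; exists z. Qed.

End LoopInverse.

Local Notation "x ^-1" := (loopV x) : group_scope.

(** * Extra loops: conjugations, nucleus and inner mappings *)

Section ExtraLoop.

Variable Q : loopType.
Hypothesis exQ : extra_loop Q.
Implicit Types x y z u v w n m : Q.

Lemma flexible x y : x * y * x = x * (y * x).
Proof. by have := exQ x y 1; rewrite mulg1 mul1g. Qed.

Lemma loop_mulKV x y : x * (x^-1 * y) = y.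
Proof.
have [z <-] := loop_divr x y.
by have := exQ x x^-1 z; rewrite loopV_rinv mul1g => <-.
Qed.

Lemma loop_mulVK x y : x^-1 * (x * y) = y.
Proof. by apply: (@loop_mulgI _ x); rewrite loop_mulKV. Qed.

Lemma loop_mulVg x : x^-1 * x = 1.
Proof. by rewrite -{2}[x]mulg1 loop_mulVK. Qed.

Lemma loop_mulgVK y x : y * x^-1 * x = y.
Proof.
have := exQ x (x^-1 * y) x^-1.
by rewrite loop_mulVg mulg1 loop_mulKV.
Qed.

Lemma loop_mulgK y x : y * x * x^-1 = y.
Proof. by apply: (@loop_mulIg _ x); rewrite loop_mulgVK. Qed.

Lemma loop_invgK x : x^-1^-1 = x.
Proof. by apply: (@loop_mulgI _ x^-1); rewrite loopV_rinv loop_mulVg. Qed.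

Lemma loop_invg_eq x y : x * y = 1 -> y = x^-1.
Proof. by move=> xy; apply: (@loop_mulgI _ x); rewrite xy loopV_rinv. Qed.

Lemma loop_invMg x y : (x * y)^-1 = y^-1 * x^-1.
Proof.
apply: (@loop_mulIg _ x); rewrite loop_mulgVK.
by rewrite -{2}[x](loop_mulgK x y) loop_mulVK.
Qed.

Definition conjl x y := x * y * x^-1.

Lemma conjlE x y : conjl x y = x * (y * x^-1).
Proof.
by apply: (@loop_mulIg _ x); rewrite loop_mulgVK flexible loop_mulgVK.
Qed.

Lemma conjlM x y : conjl x y * x = x * y.
Proof. exact: loop_mulgVK. Qed.

Lemma conjlK x y : conjl x^-1 (conjl x y) = y.
Proof. by rewrite conjlE loop_invgK /conjl loop_mulgVK loop_mulVK. Qed.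

Lemma conjlVK x y : conjl x (conjl x^-1 y) = y.
Proof. by rewrite -{1}[x]loop_invgK conjlK. Qed.

(** This is the left conjugacy closed law: the inverse property turns the
    autotopism expressed by the extra identity into one whose last two components
    are both left translation by [x].  The proof works with [w = x^-1]. *)
Lemma mulA_conj x y z : x * (y * z) = conjl x y * (x * z).
Proof.
suff H w t : w^-1 * (y * t) = conjl w^-1 y * (w^-1 * t).
  by rewrite -{1}[x]loop_invgK H loop_invgK.
have := exQ w (w^-1 * (y * t)) t^-1.
rewrite loop_mulKV loop_mulgK => E.
rewrite conjlE loop_invgK E loop_mulVK.
have -> : w^-1 * t = (t^-1 * w)^-1 by rewrite loop_invMg loop_invgK.
by rewrite loop_mulgK.
Qed.

(** The mirror image of [mulA_conj], by applying inversion. *)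
Lemma mulA_conjr x y z : (z * y) * x = (z * x) * (x^-1 * (y * x)).
Proof.
have := congr1 (@loopV Q) (mulA_conj x^-1 y^-1 z^-1).
by rewrite /conjl !loop_invMg !loop_invgK.
Qed.

Lemma moufang x y z : (x * y) * (z * x) = x * ((y * z) * x).
Proof.
rewrite [in RHS]mulA_conjr [in RHS]mulA_conj loop_mulKV; congr (_ * _).
by rewrite /conjl -flexible loop_mulgK.
Qed.

Definition nucl n := [/\ forall y z, (n * y) * z = n * (y * z),
  forall y z, (y * n) * z = y * (n * z) & forall y z, (y * z) * n = y * (z * n)].

Lemma nuclRV n : (forall y z, (y * z) * n = y * (z * n)) ->
  forall y z, (y * z) * n^-1 = y * (z * n^-1).
Proof.
by move=> Rn y z; apply: (@loop_mulIg _ n); rewrite loop_mulgVK Rn loop_mulgVK.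
Qed.

(** In an inverse property loop the three nuclei coincide: inversion exchanges
    left and right, and cancellation relates both to the middle. *)
Lemma nuclR n : (forall y z, (y * z) * n = y * (z * n)) -> nucl n.
Proof.
move=> Rn; split=> // y z.
- have := congr1 (@loopV Q) (nuclRV Rn z^-1 y^-1).
  by rewrite !loop_invMg !loop_invgK.
- apply: (@loop_mulIg _ z^-1); rewrite loop_mulgK.
  have := Rn (y * (n * z)) (n * z)^-1.
  by rewrite loop_mulgK loop_invMg loop_mulgVK.
Qed.

Lemma nuclV n : nucl n -> nucl n^-1.
Proof. by case=> _ _ Rn; apply: nuclR; apply: nuclRV. Qed.

Lemma nuclL n : (forall y z, (n * y) * z = n * (y * z)) -> nucl n.
Proof.
move=> Ln; suff /nuclV: nucl n^-1 by rewrite loop_invgK.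
apply: nuclR => y z.
have := congr1 (@loopV Q) (Ln z^-1 y^-1).
by rewrite !loop_invMg !loop_invgK.
Qed.

Lemma nuclM n : (forall y z, (y * n) * z = y * (n * z)) -> nucl n.
Proof.
move=> Mn; suff /nuclV: nucl n^-1 by rewrite loop_invgK.
apply: nuclR => y z; apply: (@loop_mulIg _ n); rewrite loop_mulgVK.
have := Mn (y * (z * n^-1)) z^-1.
have -> : n * z^-1 = (z * n^-1)^-1 by rewrite loop_invMg loop_invgK.
by rewrite loop_mulgK => E; rewrite -{1}E loop_mulgVK.
Qed.

Lemma nucl1 : nucl 1.
Proof. by split=> y z; rewrite ?mulg1 ?mul1g. Qed.

Lemma nucl_mul n m : nucl n -> nucl m -> nucl (n * m).
Proof.
case=> Ln _ _ [Lm _ _]; apply: nuclL => y z.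
by rewrite !Ln Lm.
Qed.

(** Replacing [z] by [zx] in the Moufang identity and comparing with the extra
    identity shows that multiplying twice by [x] on the right is associative with
    all left factors. *)
Lemma nucl_sq x : nucl (x * x).
Proof.
have H y z : y * z * x * x = y * (z * x * x).
  have := moufang x (x^-1 * y) (z * x).
  by rewrite loop_mulKV -flexible -exQ loop_mulKV => <-.
have A y : y * x * x = y * (x * x) by have := H y 1; rewrite mulg1 mul1g.
by apply: nuclR => y z; rewrite -!A H.
Qed.

Lemma left_alt x y : x * (x * y) = x * x * y.
Proof.
have [L _ _] := nucl_sq x.
by rewrite -{1}(loop_mulgK x x) L loop_mulVK.
Qed.

Lemma conjl_sq g y : conjl g y * conjl g y = conjl g (y * y).
Proof.
by rewrite {2}conjlE -mulA_conj left_alt -conjlE.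
Qed.

Lemma nucl_conj x n : nucl n -> nucl (conjl x n).
Proof.
case=> Ln _ _.
have K y z : conjl x n * (y * z) = conjl x (n * conjl x^-1 y) * z.
  have H w : conjl x n * w = x * (n * (x^-1 * w)) by rewrite mulA_conj loop_mulKV.
  by rewrite H (mulA_conj x^-1) -Ln mulA_conj loop_mulKV.
apply: nuclL => y z; rewrite K.
by have := K y 1; rewrite !mulg1 => <-.
Qed.

Lemma conjl_mul x n y : nucl n -> conjl x (n * y) = conjl x n * conjl x y.
Proof.
move=> Nn; have [L _ _] := nucl_conj x Nn.
by rewrite {1}/conjl mulA_conj L.
Qed.

Lemma conjl_conjl x n : nucl n -> conjl x (conjl x n) = conjl (x * x) n.
Proof.
move=> Nn; have [L _ _] := nucl_conj x (nucl_conj x Nn).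
apply: (@loop_mulIg _ (x * x)); rewrite conjlM -left_alt -(conjlM x n) -flexible.
by rewrite -[x * conjl x n]conjlM L.
Qed.

Lemma nucl_swapl x n : nucl n -> exists2 m, nucl m & x * n = m * x.
Proof.
by move=> Nn; exists (conjl x n); [apply: nucl_conj | rewrite conjlM].
Qed.

Lemma nucl_swapr x n : nucl n -> exists2 m, nucl m & n * x = x * m.
Proof.
move=> Nn; exists (conjl x^-1 n); first exact: nucl_conj.
by rewrite conjlE loop_invgK loop_mulKV.
Qed.

(** The left inner mapping usually written [L(x,y)]; it measures the failure of
    associativity. *)
Definition inner x y z := (x * y)^-1 * (x * (y * z)).

Lemma mul_inner x y z : (x * y) * inner x y z = x * (y * z).
Proof. exact: loop_mulKV. Qed.

(** Composing the autotopisms [mulA_conj] of [x] and [y] with the inverse of the one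
    of [xy] gives an autotopism whose last two components are both [inner x y].  Since
    [inner x y] fixes [1], the first component must be [inner x y] as well. *)
Lemma inner_mul x y u v : inner x y (u * v) = inner x y u * inner x y v.
Proof.
have conjl_inj w a b : conjl w a = conjl w b -> a = b.
  by move=> e; rewrite -(conjlK w a) e conjlK.
pose P := conjl (x * y)^-1 (conjl x (conjl y u)).
have E t : inner x y (u * t) = P * inner x y t.
  apply: (@loop_mulgI _ (x * y)); rewrite mul_inner [RHS]mulA_conj conjlVK.
  by rewrite mul_inner (mulA_conj y) (mulA_conj x).
have -> : inner x y u = P; last exact: E.
by have := E 1; rewrite /inner !mulg1 loop_mulVg mulg1.
Qed.

Lemma inner1 x y : inner x y 1 = 1.
Proof. by rewrite /inner mulg1 loop_mulVg. Qed.

Lemma inner_inj x y : injective (inner x y).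
Proof.
by move=> u v /loop_mulgI/loop_mulgI/loop_mulgI.
Qed.

Lemma innerV x y u : inner x y u^-1 = (inner x y u)^-1.
Proof. by apply: loop_invg_eq; rewrite -inner_mul loopV_rinv inner1. Qed.

Lemma inner_nl n x y z : nucl n -> inner (n * x) y z = inner x y z.
Proof.
move=> [Ln _ _]; apply: (@loop_mulgI _ (n * x * y)); rewrite mul_inner.
by rewrite !Ln mul_inner.
Qed.

Lemma inner_xn n x y z : nucl n -> inner (x * n) y z = inner x y z.
Proof. by move=> /(nucl_swapl x)[m Nm ->]; apply: inner_nl. Qed.

Lemma inner_ny n x y z : nucl n -> inner x (n * y) z = inner x y z.
Proof.
move=> Nn; rewrite -(inner_xn x y z Nn); have [Ln Mn _] := Nn.
by apply: (@loop_mulgI _ (x * n * y)); rewrite mul_inner !Mn -Ln mul_inner.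
Qed.

Lemma inner_yn n x y z : nucl n -> inner x (y * n) z = inner x y z.
Proof. by move=> /(nucl_swapl y)[m Nm ->]; apply: inner_ny. Qed.

Lemma inner_nucl n x y : nucl n -> inner x y n = n.
Proof.
move=> Nn; have [_ Mn Rn] := Nn.
apply: (@loop_mulgI _ (x * y)); rewrite mul_inner -!Rn.
by [].
Qed.

Lemma sqVE x : x^-1 = (x^-1 * x^-1) * x.
Proof. by rewrite loop_mulgVK. Qed.

Lemma innerVx x y z : inner x^-1 y z = inner x y z.
Proof. by rewrite sqVE inner_nl //; apply: nucl_sq. Qed.

Lemma innerVy x y z : inner x y^-1 z = inner x y z.
Proof. by rewrite sqVE inner_ny //; apply: nucl_sq. Qed.

(** This makes [inner y x] the inverse of [inner x y] in [innerK]: the conjugate of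
    [inner x y] by the translation by [xy] is [inner x y] itself. *)
Lemma inner_prod x y : inner x y (x * y) = x * y.
Proof.
apply: (@loop_mulgI _ (x * y)); rewrite mul_inner.
set a := x * y; have -> : x = a * y^-1 by rewrite loop_mulgK.
by rewrite moufang loop_mulVg mul1g.
Qed.

Lemma innerK x y : cancel (inner x y) (inner y x).
Proof.
move=> z; suff H u v w : inner u v (inner v u w) = w by rewrite H.
rewrite -(innerVx v) -(innerVy _ u) {2}/inner loop_invMg !loop_invgK.
by rewrite inner_mul inner_prod mul_inner loop_mulKV loop_mulKV.
Qed.

(** The right inner mappings are the same automorphisms, because inverting [x] and
    [y] does not change [inner x y]. *)
Lemma inner_anti x y z : (z * y) * x = inner x y z * (y * x).
Proof.
apply: (can_inj loop_invgK); rewrite (loop_invMg (z * y)) (loop_invMg z).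
rewrite (loop_invMg (inner x y z)) (loop_invMg y) -mul_inner -innerV; congr (_ * _).
by rewrite innerVx innerVy.
Qed.

(** By [mulA_conj], left translation by [y] and then by [x] is the same as left
    translation by [x] and then by [conjl x y]; and [conjl x y * x = x * y]. *)
Lemma inner_conj x y z : inner (conjl x y) x z = inner x y z.
Proof.
apply: (@loop_mulgI _ (x * y)).
by rewrite -{1}(conjlM x y) !mul_inner [RHS]mulA_conj.
Qed.

(** The commutator of the left translation by [x] and the right translation by [z] is
    an automorphism, by the Moufang identity. *)
Lemma inner_trans x y z : x * (y * z) = inner x (z * x) (x * y) * z.
Proof.
apply: (@loop_mulIg _ x); rewrite flexible -moufang.
rewrite -[in RHS](innerVx x).
have := inner_anti x^-1 (z * x) (x * y).
rewrite loop_mulgK => E; rewrite -[in RHS]E.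
by rewrite loop_mulgVK.
Qed.

(** The commutator of the autotopisms [mulA_conj] of [x] and [mulA_conjr] of [z] has
    an automorphism [g] as last component, by [inner_trans].  Removing [g] leaves an
    autotopism that says that [z^-1 * conjl x z] is in the middle nucleus. *)
Lemma commutator_nucl x z : nucl (z^-1 * conjl x z).
Proof.
set c := conjl x z.
pose g := inner x (z * x).
have main u t :
    (g (conjl x u) * z) * (z^-1 * (x * t)) = conjl x (u * z) * (x * (z^-1 * t)).
  pose v := t * z^-1; have Et : t = v * z by rewrite loop_mulgVK.
  rewrite -mulA_conj {2}Et -mulA_conjr [RHS]inner_trans (mulA_conj x u v).
  by rewrite inner_mul [RHS]mulA_conjr -inner_trans -Et.
have shift t : x * (z^-1 * t) = c^-1 * (x * t).
  have := main 1 t; rewrite /g /conjl mulg1 loopV_rinv inner1 !mul1g loop_mulKV => ->.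
  by rewrite loop_mulVK.
have H U s : (U * z) * (z^-1 * s) = (U * c) * (c^-1 * s).
  (* [g \o conjl x] is onto, so [main] holds with [U] arbitrary. *)
  pose u := conjl x^-1 (inner (z * x) x U).
  have gu : g (conjl x u) = U by rewrite /u conjlVK /g innerK.
  have main' r : (U * z) * (z^-1 * r) = conjl x (u * z) * (c^-1 * r).
    by rewrite -(loop_mulKV x r) -gu main shift.
  rewrite main'; congr (_ * _); apply: (@loop_mulIg _ c^-1).
  by have := main' 1; rewrite !mulg1 !loop_mulgK => <-.
have K V r : V * (z^-1 * (c * r)) = (V * (z^-1 * c)) * r.
  have J s : V * (z^-1 * s) = V * z^-1 * c * (c^-1 * s).
    by rewrite -H loop_mulgVK.
  by rewrite J loop_mulVK J loop_mulVg mulg1.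
apply: nuclM => V r; rewrite -K; congr (_ * _).
by have := K 1 r; rewrite !mul1g.
Qed.

Lemma conjl_comm x y : exists2 n, nucl n & conjl x y = y * n.
Proof. by exists (y^-1 * conjl x y); [apply: commutator_nucl|rewrite loop_mulKV]. Qed.

Lemma mul_comm x y : exists2 n, nucl n & x * y = (y * x) * n.
Proof.
have [n Nn E] := conjl_comm x y.
rewrite -conjlM E; have [_ Mn _] := Nn; rewrite Mn.
by have [m Nm ->] := nucl_swapr x Nn; exists m => //; have [_ _ ->] := Nm.
Qed.

(** [inner x y] is [inner (conjl x y) x], and [conjl x y] is [y] modulo the nucleus. *)
Lemma inner_sym x y z : inner x y z = inner y x z.
Proof. by rewrite -inner_conj; have [n Nn ->] := conjl_comm x y; rewrite inner_xn. Qed.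

Lemma inner_invol x y : involutive (inner x y).
Proof. by move=> z; rewrite {1}inner_sym innerK. Qed.

Lemma inner_mull x y z : inner x (x * y) z = inner x y z.
Proof.
apply: (@inner_inj x y); rewrite inner_invol.
apply: (@loop_mulgI _ (x * y)); rewrite mul_inner.
by rewrite -(innerVx x (x * y)) /inner loop_mulVK !loop_mulKV.
Qed.

Lemma inner_fixr x z : inner x z z = z.
Proof.
have := inner_prod x (x * z); rewrite inner_mull left_alt.
by rewrite inner_mul inner_nucl; [move/loop_mulgI | apply: nucl_sq].
Qed.

Lemma inner_fixl x z : inner x z x = x.
Proof. by rewrite inner_sym inner_fixr. Qed.

Lemma inner_mulr x y z : inner x (z * x) y = inner x z y.
Proof.
by have [n Nn ->] := mul_comm z x; rewrite inner_yn // inner_mull.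
Qed.

(** The middle associator is again given by an inner mapping.  Together with
    [inner_anti] this makes the associator symmetric in its three arguments. *)
Lemma mulA_mid x y z : x * (y * z) = (x * inner x z y) * z.
Proof. by rewrite inner_trans inner_mulr inner_mul inner_fixl. Qed.

Definition nuceq x y := exists2 n, nucl n & y = x * n.

Lemma nuceq_refl x : nuceq x x.
Proof. by exists 1; [apply: nucl1 | rewrite mulg1]. Qed.

Lemma nuceq_sym x y : nuceq x y -> nuceq y x.
Proof.
case=> n Nn ->; exists n^-1; first exact: nuclV.
by rewrite loop_mulgK.
Qed.

Lemma nuceq_trans x y z : nuceq x y -> nuceq y z -> nuceq x z.
Proof.
move=> [n Nn ->] [m Nm ->]; exists (n * m); first exact: nucl_mul.
by have [_ -> _] := Nn.
Qed.

Lemma nuceq_mul x x' y y' : nuceq x x' -> nuceq y y' -> nuceq (x * y) (x' * y').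
Proof.
move=> [n Nn ->] [m Nm ->].
have [n' Nn' E] := nucl_swapr y Nn.
have Nnm := nucl_mul Nn' Nm; exists (n' * m) => //.
have [_ Mn _] := Nn; have [_ Mn' _] := Nn'.
have [_ _ Rm] := Nm; have [_ _ Rnm] := Nnm.
by rewrite Mn -Rm E Mn' Rnm.
Qed.

Lemma nuceq_comm x y : nuceq (x * y) (y * x).
Proof. exact: mul_comm. Qed.

Lemma nuceq_sql x y : nuceq (x * (x * y)) y.
Proof.
apply: nuceq_sym; rewrite left_alt.
by have [m Nm ->] := nucl_swapr y (nucl_sq x); exists m.
Qed.

(** Modulo the nucleus the loop is commutative and squares vanish, so the Moufang
    identity [(yx)(wy) = y((xw)y)] reduces to the congruence of [(yx)(wy)] and [xw].
    This is associativity for [z = wy], since then [yz] is congruent to [w]. *)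
Lemma nuceq_assoc x y z : nuceq ((x * y) * z) (x * (y * z)).
Proof.
set w := z * y^-1; have -> : z = w * y by rewrite loop_mulgVK.
have yw : nuceq (y * (w * y)) w.
  exact: nuceq_trans (nuceq_mul (nuceq_refl y) (nuceq_comm w y)) (nuceq_sql y w).
apply: nuceq_trans (nuceq_mul (nuceq_comm x y) (nuceq_refl _)) _.
rewrite moufang; apply: nuceq_trans (nuceq_mul (nuceq_refl y) (nuceq_comm _ y)) _.
apply: nuceq_trans (nuceq_sql y _) _.
exact: nuceq_mul (nuceq_refl x) (nuceq_sym yw).
Qed.

Lemma inner_nuceq x y z : nuceq z (inner x y z).
Proof.
have [n Nn E] := nuceq_assoc x y z; exists n => //.
apply: (@loop_mulgI _ (x * y)); rewrite mul_inner E.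
by have [_ _ ->] := Nn.
Qed.

(** By [nuceq_assoc] this element is nuclear; it is the associator of [x], [y], [z],
    up to its position in the product. *)
Definition asc x y z := z^-1 * inner x y z.

Lemma innerE x y z : inner x y z = z * asc x y z.
Proof. by rewrite loop_mulKV. Qed.

Lemma asc_nucl x y z : nucl (asc x y z).
Proof. by rewrite /asc; have [n Nn ->] := inner_nuceq x y z; rewrite loop_mulVK. Qed.

(** The involution [inner x y] fixes nuclear elements, in particular [asc x y z]. *)
Lemma asc_sq x y z : asc x y z * asc x y z = 1.
Proof.
apply: (@loop_mulgI _ z); rewrite mulg1 -[RHS](inner_invol x y) (innerE x y z).
rewrite inner_mul (inner_nucl _ _ (asc_nucl _ _ _)) innerE.
by have [_ _ ->] := asc_nucl x y z.
Qed.

(** With [m = z n z^-1], apply the automorphism [inner x y] to both sides of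
    [z n = m z]. *)
Lemma asc_comm_nucl n x y z : nucl n -> asc x y z * n = n * asc x y z.
Proof.
move=> Nn; have [m Nm E] := nucl_swapl z Nn.
apply: (@loop_mulgI _ z); have [_ _ Rn] := Nn; have [Lm _ _] := Nm.
rewrite -Rn -innerE -{1}(inner_nucl x y Nn) -inner_mul E inner_mul.
rewrite (inner_nucl x y Nm) innerE.
by have [_ _ Ra] := asc_nucl x y z; rewrite -Ra -Ra E.
Qed.

End ExtraLoop.

(** * Loops in which all associators lie in a central group of order two *)

Definition bpow (Q : loopType) (x : Q) (b : bool) : Q := if b then x else 1.

(** The situation of a code loop: associators take the two values [1] and [e] only, so
    they can be treated as bits. *)
Record associator_involution (Q : loopType) (e : Q) : Prop := AssociatorInvolution {
  ai_nucl : nucl e;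
  ai_central : forall x, e * x = x * e;
  ai_sq : e * e = 1;
  ai_neq1 : e <> 1;
  ai_asc : forall x y z : Q, asc x y z = 1 \/ asc x y z = e }.

Section SingleAssociator.

Variable Q : loopType.
Hypothesis exQ : extra_loop Q.
Implicit Types x y z u v w n m : Q.
Variable e : Q.
Hypothesis ai : associator_involution e.

Local Notation e_nucl := (ai_nucl ai).
Local Notation e_central := (ai_central ai).
Local Notation e_sq := (ai_sq ai).
Local Notation e_neq1 := (ai_neq1 ai).
Local Notation asc_e := (ai_asc ai).

(** Powers of [e] are collected on the right in this form, which moves freely through
    products. *)
Definition twist x (b : bool) := x * bpow e b.

Lemma bpow_e_nucl b : nucl (bpow e b).
Proof. by case: b; [apply: e_nucl | apply: nucl1]. Qed.

Lemma twist0 x : twist x false = x.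
Proof. exact: mulg1. Qed.

Lemma twistl x b y : twist x b * y = twist (x * y) b.
Proof.
case: b; rewrite ?twist0 // /twist; have [_ M R] := e_nucl.
by rewrite M R e_central.
Qed.

Lemma twistr x b y : x * twist y b = twist (x * y) b.
Proof. by rewrite /twist; have [_ _ ->] := bpow_e_nucl b. Qed.

Lemma twist_twist x b c : twist (twist x b) c = twist x (b (+) c).
Proof.
rewrite /twist; have [_ -> _] := bpow_e_nucl b; congr (_ * _).
by case: b; case: c; rewrite /= ?mul1g ?mulg1 ?(ai_sq ai).
Qed.

Lemma twist_inj x b c : twist x b = twist x c -> b = c.
Proof.
move=> /loop_mulgI; by case: b; case: c => //= E; case: e_neq1; rewrite E.
Qed.

Lemma twist_injl x y b : twist x b = twist y b -> x = y.
Proof. exact: loop_mulIg. Qed.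

Definition ascb x y z := inner x y z != z.

Lemma inner_twist x y z : inner x y z = twist z (ascb x y z).
Proof.
rewrite /ascb (innerE exQ x y z); case: (asc_e x y z) => ->.
  by rewrite mulg1 eqxx twist0.
have -> : z * e != z by apply/eqP; rewrite -{2}[z]mulg1 => /loop_mulgI; apply: e_neq1.
by [].
Qed.

Lemma mulA_twist x y z : x * (y * z) = twist (x * y * z) (ascb x y z).
Proof. by rewrite -[LHS](mul_inner exQ) inner_twist twistr. Qed.

Lemma ascb_symml x y z : ascb x y z = ascb y x z.
Proof. by rewrite /ascb inner_sym. Qed.

(** Both [inner_anti] and [mulA_mid] rebracket [a (b c)], and comparing them exchanges
    the outer arguments of the associator. *)
Lemma ascb_symmr x y z : ascb x y z = ascb x z y.
Proof.
rewrite ascb_symml [RHS]ascb_symml.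
suff H a b c : ascb c b a = ascb a c b by rewrite (H z) ascb_symml -H ascb_symml -H.
have E1 : a * (b * c) = twist (a * b * c) (ascb c b a).
  rewrite -{1}[a](inner_invol exQ c b) -inner_anti // inner_twist.
  by rewrite !twistl.
have := mulA_mid exQ a b c; rewrite E1 inner_twist twistr twistl; exact: twist_inj.
Qed.

Lemma ascbDr x y u v : ascb x y (u * v) = ascb x y u (+) ascb x y v.
Proof.
apply: (@twist_inj (u * v)); rewrite -inner_twist inner_mul // !inner_twist.
by rewrite twistl twistr twist_twist addbC.
Qed.

Lemma ascbDm x y u v : ascb x (u * v) y = ascb x u y (+) ascb x v y.
Proof. by rewrite ascb_symmr ascbDr; congr (_ (+) _); rewrite ascb_symmr. Qed.

Lemma ascbDl x y u v : ascb (u * v) x y = ascb u x y (+) ascb v x y.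
Proof. by rewrite ascb_symml ascbDm; congr (_ (+) _); rewrite ascb_symml. Qed.

Lemma ascb_rr x y : ascb x y y = false.
Proof. by rewrite /ascb inner_fixr ?eqxx. Qed.

Lemma ascb_lr x y : ascb y x y = false.
Proof. by rewrite ascb_symml ascb_rr. Qed.

Lemma ascb_ll x y : ascb x x y = false.
Proof. by rewrite ascb_symmr ascb_lr. Qed.

Lemma ascb_nuclr n x y : nucl n -> ascb x y n = false.
Proof. by move=> Nn; rewrite /ascb inner_nucl ?eqxx. Qed.

Lemma ascb_bpowr x y z b : ascb x y (bpow z b) = b && ascb x y z.
Proof. by case: b => //=; rewrite ascb_nuclr //; apply: nucl1. Qed.

Lemma ascb_bpowm x y z b : ascb x (bpow z b) y = b && ascb x z y.
Proof. by rewrite ascb_symmr ascb_bpowr ascb_symmr. Qed.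

Lemma ascb_bpowl x y z b : ascb (bpow z b) x y = b && ascb z x y.
Proof. by rewrite ascb_symml ascb_bpowm ascb_symml. Qed.

Lemma ascb_assoc x y z : ascb x y z = false -> (x * y) * z = x * (y * z).
Proof. by rewrite mulA_twist => ->; rewrite twist0. Qed.

(* Moving one right factor past another costs only the commutator. *)
(** The two associators that arise when [a] is moved past [c] cancel, by symmetry. *)
Lemma mul_swap a b c t : c * a = twist (a * c) t -> (b * c) * a = twist ((b * a) * c) t.
Proof.
move=> E; apply: (@twist_injl _ _ (ascb b c a)).
by rewrite -mulA_twist E twistr mulA_twist !twist_twist addbC ascb_symmr.
Qed.

End SingleAssociator.

(** * The models *)

Definition vec := (bool * bool * bool)%type.

Definition addv (u v : vec) : vec :=
  (u.1.1 (+) v.1.1, u.1.2 (+) v.1.2, u.2 (+) v.2).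

(** The squares and commutators of three generators, as exponents of the central
    involution, and whether the first generator inverts the cyclic group of order
    [p].  The other two generators can always be chosen to centralize it. *)
Record invariants := Invariants {
  sq1 : bool; sq2 : bool; sq3 : bool;
  cm12 : bool; cm13 : bool; cm23 : bool;
  dih : bool }.

(** The exponent of the central involution that appears when two words
    [x^u1 y^u2 z^u3] and [x^v1 y^v2 z^v3] are multiplied and brought to this form
    again.  The quadratic terms come from squares and commutators, the cubic ones
    from associators; see [word_mul]. *)
Definition cocycle (P : invariants) (u v : vec) : bool :=
  let: (u1, u2, u3) := u in let: (v1, v2, v3) := v in
  (sq1 P && u1 && v1) (+) (sq2 P && u2 && v2) (+) (sq3 P && u3 && v3) (+)
  (cm12 P && u2 && v1) (+) (cm13 P && u3 && v1) (+) (cm23 P && u3 && v2) (+)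
  (u1 && v2 && v3) (+) (u2 && v1 && v3) (+) (u3 && v1 && v2).

Definition inverts (P : invariants) (u : vec) := dih P && u.1.1.

Definition sgnz (p : nat) (b : bool) (m : 'Z_p) : 'Z_p := if b then (- m)%R else m.

(** The fibre product over [vec] of a code loop of order 16 and of the group in which
    [vec] acts on ['Z_p] through the sign [inverts P]. *)
Definition model (p : nat) (P : invariants) := (vec * bool * 'Z_p)%type.

Section Model.

Variables (p : nat) (P : invariants).

HB.instance Definition _ := Finite.copy (model p P) (vec * bool * 'Z_p)%type.

Definition model_mul (x y : model p P) : model p P :=
  (addv x.1.1 y.1.1, x.1.2 (+) y.1.2 (+) cocycle P x.1.1 y.1.1,
   (sgnz (inverts P y.1.1) x.2 + y.2)%R).

Definition model_one : model p P := ((false, false, false), false, 0%R).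

Lemma model_mul1g : left_id model_one model_mul.
Proof.
case=> -[[[u1 u2] u3] a] m; rewrite /model_mul /=.
rewrite (_ : sgnz _ _ = 0%R) ?GRing.add0r; last by rewrite /sgnz GRing.oppr0 if_same.
by rewrite !andbF /= addbF.
Qed.

Lemma model_mulg1 : right_id model_one model_mul.
Proof.
case=> -[[[u1 u2] u3] a] m; rewrite /model_mul /inverts /= !andbF /=.
by rewrite GRing.addr0 /addv /= !addbF.
Qed.

HB.instance Definition _ := hasMul.Build (model p P) model_mul.
HB.instance Definition _ := Magma_isUMagma.Build (model p P) model_mul1g model_mulg1.

Lemma addvI u : injective (addv u).
Proof.
by move: u => [[u1 u2] u3] [[v1 v2] v3] [[w1 w2] w3] [] /addbI-> /addbI-> /addbI->.
Qed.

Lemma addvC u v : addv u v = addv v u.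
Proof. by rewrite /addv addbC (addbC u.1.2) (addbC u.2). Qed.

Lemma model_mulgI (x : model p P) : injective (mul x).
Proof.
case: x => -[u a] m [[v b] n] [[w c] k] /pair_equal_spec[/pair_equal_spec[/= E1 E2] E3].
have {}E1 := addvI E1; move: E2 E3; rewrite E1 => /addIb/addbI->.
by move/GRing.addrI->.
Qed.

Lemma model_mulIg (x : model p P) : injective (mul^~ x).
Proof.
case: x => -[u a] m [[v b] n] [[w c] k] /pair_equal_spec[/pair_equal_spec[/= E1 E2] E3].
have {}E1 : v = w by apply: (@addvI u); rewrite addvC E1 addvC.
move: E2 E3; rewrite E1 => /addIb/addIb-> /GRing.addIr; rewrite /sgnz.
by case: ifP => _ => [/GRing.oppr_inj|] ->.
Qed.

Lemma model_ldiv (x y : model p P) : exists! z, x * z = y.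
Proof.
have [g gK Kg] := injF_bij (@model_mulgI x).
by exists (g y); split=> [|z <-]; [apply: Kg | apply: gK].
Qed.

Lemma model_rdiv (x y : model p P) : exists! z, z * x = y.
Proof.
have [g gK Kg] := injF_bij (@model_mulIg x).
by exists (g y); split=> [|z <-]; [apply: Kg | apply: gK].
Qed.

HB.instance Definition _ := UMagma_isLoop.Build (model p P) model_ldiv model_rdiv.

End Model.

Lemma card_model p P : prime p -> #|{: model p P}| = (16 * p)%N.
Proof.
move=> p_pr; rewrite !card_prod card_bool card_ord Zp_cast ?prime_gt1 //.
Qed.

(** Quantifiers over finite sets of bits as plain boolean functions that stop early,
    so that statements about all models can be checked by computation. *)
Definition allb (F : bool -> bool) := if F true then F false else false.

Lemma allbP F : allb F -> forall b, F b.
Proof. by rewrite /allb; case: ifP => // Ft Ff []. Qed.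

Definition allv (F : vec -> bool) :=
  allb (fun a => allb (fun b => allb (fun c => F (a, b, c)))).

Lemma allvP F : allv F -> forall u, F u.
Proof. by move=> H [[a b] c]; move/allbP: H => /(_ a)/allbP/(_ b)/allbP/(_ c). Qed.

Definition alli (F : invariants -> bool) :=
  allv (fun s => allv (fun t => allb (fun d =>
    F (Invariants s.1.1 s.1.2 s.2 t.1.1 t.1.2 t.2 d)))).

Lemma alliP F : alli F -> forall P, F P.
Proof.
move=> H [a b c d f g h].
by move/allvP: H => /(_ (a, b, c)) /allvP/(_ (d, f, g)) /allbP/(_ h).
Qed.

(** The determinant over the field with two elements. *)
Definition detv (u v w : vec) : bool :=
  let: (u1, u2, u3) := u in let: (v1, v2, v3) := v in let: (w1, w2, w3) := w in
  (u1 && v2 && w3) (+) (u1 && v3 && w2) (+) (u2 && v1 && w3) (+)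
  (u2 && v3 && w1) (+) (u3 && v1 && w2) (+) (u3 && v2 && w1).

Lemma cocycle_assoc P u v w :
  cocycle P u v (+) cocycle P (addv u v) w =
  cocycle P v w (+) cocycle P u (addv v w) (+) detv u v w.
Proof.
apply/eqP; move: P u v w.
have H : alli (fun P => allv (fun u => allv (fun v => allv (fun w =>
  cocycle P u v (+) cocycle P (addv u v) w ==
  cocycle P v w (+) cocycle P u (addv v w) (+) detv u v w)))).
  by vm_compute.
by move=> P u v w; move/alliP: H => /(_ P)/allvP/(_ u)/allvP/(_ v)/allvP/(_ w).
Qed.

Lemma cocycle_extra P u v w :
  cocycle P u v (+) cocycle P (addv u v) w (+) cocycle P (addv (addv u v) w) u =
  cocycle P w u (+) cocycle P v (addv w u) (+) cocycle P u (addv v (addv w u)).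
Proof.
apply/eqP; move: P u v w.
have H : alli (fun P => allv (fun u => allv (fun v => allv (fun w =>
  cocycle P u v (+) cocycle P (addv u v) w (+) cocycle P (addv (addv u v) w) u ==
  cocycle P w u (+) cocycle P v (addv w u) (+) cocycle P u (addv v (addv w u)))))).
  by vm_compute.
by move=> P u v w; move/alliP: H => /(_ P)/allvP/(_ u)/allvP/(_ v)/allvP/(_ w).
Qed.

Section SignedAction.
Variable p : nat.
Implicit Types m n : 'Z_p.

Lemma sgnzD b m n : sgnz b (m + n)%R = (sgnz b m + sgnz b n)%R.
Proof. by case: b; rewrite //= GRing.opprD. Qed.

Lemma sgnz_sgnz b c m : sgnz b (sgnz c m) = sgnz (b (+) c) m.
Proof. by case: b; case: c; rewrite //= GRing.opprK. Qed.

End SignedAction.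

Lemma invertsD P u v : inverts P (addv u v) = inverts P u (+) inverts P v.
Proof. by rewrite /inverts /=; case: dih. Qed.

Lemma addvA u v w : addv (addv u v) w = addv u (addv v w).
Proof. by rewrite /addv /= !addbA. Qed.

Arguments cocycle : simpl never.
Arguments addv : simpl never.
Arguments inverts : simpl never.

Lemma inverts0 P : inverts P (false, false, false) = false.
Proof. exact: andbF. Qed.

Section ModelTheory.

Variables (p : nat) (P : invariants).
Local Notation L := (model p P).
Implicit Types x y z : L.

Lemma model_mulE u a m v b n :
  ((u, a, m) : L) * ((v, b, n) : L) =
  (addv u v, a (+) b (+) cocycle P u v, (sgnz (inverts P v) m + n)%R) :> L.
Proof. by []. Qed.

Definition model_e : L := ((false, false, false), true, 0%R).
Definition model_c (m : 'Z_p) : L := ((false, false, false), false, m).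
Definition model_v (u : vec) : L := (u, false, 0%R).

Lemma model_eE b : bpow model_e b = ((false, false, false), b, 0%R).
Proof. by case: b. Qed.

Lemma cocycle0r u : cocycle P u (false, false, false) = false.
Proof. by case: u => [[u1 u2] u3]; rewrite /cocycle !andbF. Qed.

Lemma cocycle0l u : cocycle P (false, false, false) u = false.
Proof. by case: u => [[u1 u2] u3]; rewrite /cocycle !andbF. Qed.

Lemma addv0 u : addv u (false, false, false) = u.
Proof. by case: u => [[u1 u2] u3]; rewrite /addv /= !addbF. Qed.

(** The associator of three elements is the determinant of their images in [vec]: the
    coboundary of [cocycle P] is the same for all values of the invariants. *)
Lemma model_assoc x y z :
  (x * y) * z = (x * (y * z)) * bpow model_e (detv x.1.1 y.1.1 z.1.1).
Proof.
case: x y z => [[u a] m] [[v b] n] [[w c] k].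
rewrite model_eE !model_mulE !sgnzD !sgnz_sgnz invertsD inverts0 /=.
rewrite addv0 cocycle0r addbF addvA GRing.addr0 GRing.addrA (addbC (inverts P v)).
congr (_, _, _); have := cocycle_assoc P u v w.
case: (cocycle P u v) (cocycle P (addv u v) w) => [] [];
case: (cocycle P v w) (cocycle P u (addv v w)) => [] [];
by case: (detv u v w) a b c => [] // [] [] [].
Qed.

Lemma extra_model : extra_loop L.
Proof.
move=> [[u a] m] [[v b] n] [[w c] k]; rewrite !model_mulE.
rewrite !sgnzD !sgnz_sgnz !invertsD addvA.
congr (_, _, _).
- by rewrite !addvA.
- have := cocycle_extra P u v w; rewrite addvA.
  case: (cocycle P u v) (cocycle P (addv u v) w) (cocycle P _ u) => [] [] [];
  case: (cocycle P w u) (cocycle P v _) (cocycle P u _) => [] [] [] //;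
  by case: a b c => [] [] [].
rewrite !GRing.addrA; congr (sgnz _ _ + sgnz _ _ + _ + _)%R.
- by case: (inverts P u) (inverts P v) (inverts P w) => [] [] [].
- by rewrite addbC.
Qed.

Lemma model_nonassoc : nonassociative L.
Proof.
move=> assoc.
have := model_assoc (model_v (true, false, false)) (model_v (false, true, false))
  (model_v (false, false, true)).
rewrite assoc -[LHS]mulg1 => /loop_mulgI.
by rewrite model_eE.
Qed.

Lemma model_e_mul x b : x * bpow model_e b = (x.1.1, x.1.2 (+) b, x.2).
Proof.
case: x => [[u a] m]; rewrite model_eE model_mulE /= addv0 cocycle0r inverts0 addbF.
by rewrite GRing.addr0.
Qed.

Lemma model_e_central x : model_e * x = x * model_e.
Proof.
rewrite -[model_e in RHS]/(bpow model_e true) model_e_mul.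
case: x => [[u a] m]; rewrite model_mulE cocycle0l addvC addv0 addbF addbC /=.
by rewrite /sgnz GRing.oppr0 if_same GRing.add0r.
Qed.

Lemma model_e_sq : model_e * model_e = 1.
Proof. by rewrite model_mulE cocycle0l addv0 /sgnz GRing.oppr0 if_same GRing.addr0. Qed.

Lemma model_nucl x : x.1.1 = (false, false, false) -> nucl x.
Proof.
move=> x0; apply: (nuclR extra_model) => y z; rewrite model_assoc x0.
by rewrite /detv; case: y z => [[[[u1 u2] u3] a] m] [[[[v1 v2] v3] b] n];
   rewrite /= !andbF mulg1.
Qed.

Lemma model_e_nucl b : nucl (bpow model_e b).
Proof. by rewrite model_eE; apply: model_nucl. Qed.

Lemma model_asc x y z : asc x y z = 1 \/ asc x y z = model_e.
Proof.
have E : inner x y z = z * bpow model_e (detv x.1.1 y.1.1 z.1.1).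
  apply: (@loop_mulgI _ (x * y)); rewrite mul_inner; last exact: extra_model.
  have [_ _ <-] := model_e_nucl (detv x.1.1 y.1.1 z.1.1).
  rewrite (model_assoc x y z); move: (x * (y * z)) (detv _ _ _) => [[u a] m] d.
  by rewrite !model_e_mul /= -addbA addbb addbF.
rewrite /asc E loop_mulVK; last exact: extra_model.
by case: detv; [right | left].
Qed.

Lemma model_cD m n : model_c (m + n)%R = model_c m * model_c n.
Proof. by rewrite model_mulE cocycle0r addv0 inverts0. Qed.

Lemma model_c_inj : injective model_c.
Proof. by move=> m n []. Qed.

(** The components in ['Z_p] are inverted precisely by the elements on which the
    linear form [inverts P] does not vanish. *)
Lemma model_c_comm x m : model_c m * x = x * model_c (sgnz (inverts P x.1.1) m).
Proof.
case: x => [[u a] n]; rewrite !model_mulE /= cocycle0l cocycle0r inverts0.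
rewrite addvC /= !addbF; by rewrite GRing.addrC.
Qed.

Lemma model_v_mul u v :
  model_v u * model_v v = (addv u v, cocycle P u v, 0%R).
Proof. by rewrite model_mulE /sgnz GRing.oppr0 if_same GRing.addr0. Qed.

End ModelTheory.

(** * Recovering the multiplication from generators *)

Lemma Zp_double_eq0 p (m : 'Z_p) : prime p -> odd p -> (m + m = 0 -> m = 0)%R.
Proof.
move=> p_pr p_odd mm0; apply/val_inj => /=.
have p_gt1 := prime_gt1 p_pr.
have pE : (Zp_trunc p).+2 = p by apply: Zp_cast.
have mm_p : (m + m) %% p = 0.
  by rewrite -[RHS](congr1 val mm0); congr (_ %% _).
have pm : p %| m.
  by rewrite -(@Gauss_dvdl _ _ 2) ?coprimen2 // muln2 -addnn /dvdn mm_p.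
have m_lt : m < p by apply: leq_trans (ltn_ord m) _; rewrite pE.
by apply/eqP; rewrite -(modn_small m_lt).
Qed.

Section Frame.

Variables (Q : finLoopType) (p : nat).
Hypothesis exQ : extra_loop Q.
Hypothesis p_pr : prime p.
Hypothesis p_odd : odd p.
Variables (e : Q) (cp : 'Z_p -> Q).

(** The data that a nucleus of order [2p] provides: the central involution [e] and an
    embedding [cp] of the cyclic group of order [p]. *)
Record split_center : Prop := SplitCenter {
  sc_ai : associator_involution e;
  sc_cp_nucl : forall m, nucl (cp m);
  sc_cpD : forall m n, cp (m + n)%R = cp m * cp n;
  sc_cp_inj : injective cp }.

(** Generators modulo the nucleus whose squares and commutators are powers of [e] and
    of which only the first may invert the image of [cp]. *)
Record frame (P : invariants) (x y z : Q) : Prop := Frame {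
  fr_asc : inner x y z <> z;
  fr_sq1 : x * x = bpow e (sq1 P);
  fr_sq2 : y * y = bpow e (sq2 P);
  fr_sq3 : z * z = bpow e (sq3 P);
  fr_cm12 : y * x = (x * y) * bpow e (cm12 P);
  fr_cm13 : z * x = (x * z) * bpow e (cm13 P);
  fr_cm23 : z * y = (y * z) * bpow e (cm23 P);
  fr_cpx : forall m, cp m * x = x * cp (sgnz (dih P) m);
  fr_cpy : forall m, cp m * y = y * cp m;
  fr_cpz : forall m, cp m * z = z * cp m }.

Hypothesis sc : split_center.
Local Notation ai := (sc_ai sc).

Lemma cp0 : cp 0%R = 1.
Proof.
apply: (@loop_mulgI _ (cp 0%R)); rewrite mulg1 -(sc_cpD sc).
by rewrite GRing.addr0.
Qed.

Lemma cp_neq_e m : cp m <> e.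
Proof.
move=> E; apply: (ai_neq1 ai); rewrite -E.
suff -> : m = 0%R by exact: cp0.
apply: (Zp_double_eq0 p_pr p_odd); apply: (sc_cp_inj sc).
by rewrite (sc_cpD sc) cp0 E (ai_sq ai).
Qed.

Lemma twist_cp_inj a b m n : twist e (cp m) a = twist e (cp n) b -> a = b /\ m = n.
Proof.
suff H c k l : cp k = twist e (cp l) c -> c = false /\ k = l.
  move=> E; have /H[] : cp m = twist e (cp n) (b (+) a).
    by rewrite -(twist_twist ai) -E (twist_twist ai) addbb twist0.
  by move/eqP; rewrite -[_ == _]negb_add; case: a b {E} => [] [].
case: c => /= E; last by split=> //; apply: (sc_cp_inj sc); rewrite E twist0.
case: (@cp_neq_e (k - l)%R); apply: (@loop_mulgI _ (cp l)).
by rewrite -(sc_cpD sc) GRing.addrC GRing.subrK.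
Qed.

Variables (P : invariants) (x y z : Q).
Hypothesis fr : frame P x y z.

Local Notation tw := (twist e).
Local Notation twl := (twistl ai).
Local Notation twr := (twistr ai).
Local Notation twtw := (twist_twist ai).

Definition word (u : vec) : Q := bpow x u.1.1 * bpow y u.1.2 * bpow z u.2.

Lemma ascb_xyz : ascb x y z.
Proof. by apply/eqP; exact: fr_asc fr. Qed.

Let ascbE := (ascbDl exQ ai, ascbDm exQ ai, ascbDr exQ ai,
  ascb_bpowl exQ ai, ascb_bpowm exQ ai, ascb_bpowr exQ,
  ascb_ll exQ ai, ascb_lr exQ, ascb_rr exQ, andbF, addbF).

Lemma bpow_mulr g s u : g * g = bpow e s -> bpow g u * g = tw (bpow g (~~ u)) (s && u).
Proof.
move=> E; case: u; rewrite /= ?andbT ?andbF ?twist0 ?mul1g //.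
by rewrite E /twist mul1g.
Qed.

Lemma bpow_swap a c u t :
  c * a = (a * c) * bpow e t -> bpow c u * a = tw (a * bpow c u) (t && u).
Proof. by move=> E; case: u; rewrite /= ?andbT ?andbF ?twist0 ?mul1g ?mulg1. Qed.

Lemma word_mulz u : word u * z = tw (word (u.1, ~~ u.2)) (sq3 P && u.2).
Proof.
case: u => [[u1 u2] u3]; rewrite /word /=.
rewrite [LHS](ascb_assoc exQ ai); last by rewrite !ascbE.
by rewrite -[RHS]twr (bpow_mulr _ (fr_sq3 fr)).
Qed.

(** In this lemma and the next one, moving [y] or [x] to its place costs commutators
    but no associators, by [mul_swap]. *)
Lemma word_muly u :
  word u * y = tw (word (u.1.1, ~~ u.1.2, u.2)) ((sq2 P && u.1.2) (+) (cm23 P && u.2)).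
Proof.
case: u => [[u1 u2] u3]; rewrite /word /=.
rewrite (mul_swap exQ ai _ (bpow_swap u3 (fr_cm23 fr))) -[RHS]twtw; congr (tw _ _).
rewrite -[RHS]twl; congr (_ * _).
rewrite (ascb_assoc exQ ai); last by rewrite !ascbE.
by rewrite -[RHS]twr (bpow_mulr _ (fr_sq2 fr)).
Qed.

Lemma word_mulx u :
  word u * x = tw (word (~~ u.1.1, u.1.2, u.2))
    ((sq1 P && u.1.1) (+) (cm12 P && u.1.2) (+) (cm13 P && u.2)).
Proof.
case: u => [[u1 u2] u3]; rewrite /word /=.
rewrite (mul_swap exQ ai _ (bpow_swap u3 (fr_cm13 fr))) -[RHS]twtw; congr (tw _ _).
rewrite -[RHS]twl; congr (_ * _).
rewrite (mul_swap exQ ai _ (bpow_swap u2 (fr_cm12 fr))) -[RHS]twtw; congr (tw _ _).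
rewrite -[RHS]twl; congr (_ * _).
exact: (bpow_mulr _ (fr_sq1 fr)).
Qed.

Lemma mul_bpow (w g : Q) b : w * bpow g b = if b then w * g else w.
Proof. by case: b; rewrite ?mulg1. Qed.

Lemma ascb_yxz : ascb y x z.
Proof. by rewrite (ascb_symml exQ) ascb_xyz. Qed.

Lemma ascb_zxy : ascb z x y.
Proof. by rewrite (ascb_symml exQ) (ascb_symmr exQ ai) ascb_xyz. Qed.

(** Multiplying by [x], [y] and [z] in turn gives the quadratic terms of the cocycle;
    splitting the second word into its letters gives two associators, that is the
    cubic terms. *)
Lemma word_mul u v : word u * word v = tw (word (addv u v)) (cocycle P u v).
Proof.
rewrite {2}/word (mulA_twist exQ ai) (mulA_twist exQ ai) twl twtw.
rewrite {2 3}/word !ascbE.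
rewrite ascb_xyz ascb_yxz ascb_zxy !andbT.
rewrite !mul_bpow; case: u v => [[u1 u2] u3] [[v1 v2] v3] /=.
have E1 : (if v1 then word (u1, u2, u3) * x else word (u1, u2, u3)) =
  tw (word (u1 (+) v1, u2, u3))
    (v1 && ((sq1 P && u1) (+) (cm12 P && u2) (+) (cm13 P && u3))).
  by case: v1; rewrite ?word_mulx ?addbT ?addbF ?twist0.
have E2 w : (if v2 then word (w, u2, u3) * y else word (w, u2, u3)) =
  tw (word (w, u2 (+) v2, u3)) (v2 && ((sq2 P && u2) (+) (cm23 P && u3))).
  by case: v2; rewrite ?word_muly ?addbT ?addbF ?twist0.
have E3 w w' : (if v3 then word (w, w', u3) * z else word (w, w', u3)) =
  tw (word (w, w', u3 (+) v3)) (v3 && (sq3 P && u3)).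
  by case: v3; rewrite ?word_mulz ?addbT ?addbF ?twist0.
rewrite E1 twl -(fun_if (fun q => tw q _)) E2 twtw twl.
rewrite -(fun_if (fun q => tw q _)) E3 !twtw /addv /=.
congr (tw _ _); rewrite /cocycle; clear E1 E2 E3.
move: (sq1 P) (sq2 P) (sq3 P) (cm12 P) (cm13 P) (cm23 P) => s1 s2 s3 t1 t2 t3.
by case: v1; case: v2; case: v3; rewrite /= ?andbF ?andbT ?addbF ?andbF;
  case: u1; case: u2; case: u3; rewrite /= ?andbF ?andbT ?addbF;
  case: s1; case: s2; case: s3; case: t1; case: t2; case: t3.
Qed.

Lemma cp_word m u : cp m * word u = word u * cp (sgnz (inverts P u) m).
Proof.
case: u => [[u1 u2] u3]; rewrite /word /inverts /=.
have X : cp m * bpow x u1 = bpow x u1 * cp (sgnz (dih P && u1) m).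
  case: u1; rewrite /= ?andbT ?andbF ?mul1g ?mulg1 //; exact: fr_cpx fr m.
set m' := sgnz _ m in X *; have Nm' := sc_cp_nucl sc m'.
have Y : cp m' * bpow y u2 = bpow y u2 * cp m'.
  by case: u2; rewrite /= ?mul1g ?mulg1 //; exact: fr_cpy fr m'.
have Z : cp m' * bpow z u3 = bpow z u3 * cp m'.
  by case: u3; rewrite /= ?mul1g ?mulg1 //; exact: fr_cpz fr m'.
have [Lm _ _] := sc_cp_nucl sc m; have [_ Mm' Rm'] := Nm'.
by rewrite -!Lm X Mm' Y -Rm' Mm' Z Rm'.
Qed.

Definition frame_map (q : model p P) : Q := tw (word q.1.1 * cp q.2) q.1.2.

Lemma frame_map_mul : {morph frame_map : q r / q * r}.
Proof.
move=> [[u a] m] [[v b] n]; rewrite /frame_map model_mulE /=.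
rewrite twl twr twtw (sc_cpD sc).
have [_ Mm _] := sc_cp_nucl sc m.
have [Ls Ms Rs] := sc_cp_nucl sc (sgnz (inverts P v) m).
have [_ _ Rn] := sc_cp_nucl sc n.
have -> : word u * cp m * (word v * cp n) =
    tw (word (addv u v) * (cp (sgnz (inverts P v) m) * cp n)) (cocycle P u v).
  by rewrite Mm -(Rn (cp m)) cp_word -Rn -Rs word_mul !twl Ms.
by rewrite twtw; congr (tw _ _); case: a b (cocycle _ _ _) => [] [] [].
Qed.

Lemma ascb_word u : [/\ ascb z y (word u) = u.1.1, ascb x z (word u) = u.1.2
  & ascb x y (word u) = u.2].
Proof.
case: u => [[u1 u2] u3]; rewrite /word !ascbE /=.
by rewrite (ascb_symmr exQ ai z y) (ascb_symmr exQ ai x z) ascb_xyz ascb_zxy !andbT.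
Qed.

(** The associators of a word with pairs of generators recover its exponents. *)
Lemma frame_map_inj : injective frame_map.
Proof.
have C q a b : ascb a b (frame_map q) = ascb a b (word q.1.1).
  case: q => [[u c] m]; rewrite /frame_map /twist /= !ascbE.
  rewrite (ascb_nuclr exQ _ _ (sc_cp_nucl sc m)) (ascb_nuclr exQ _ _ (ai_nucl ai)).
  by rewrite andbF !addbF.
move=> q r E.
have Eu : q.1.1 = r.1.1.
  have [Q1 Q2 Q3] := ascb_word q.1.1; have [R1 R2 R3] := ascb_word r.1.1.
  move: Q1 Q2 Q3; rewrite -!C E !C R1 R2 R3.
  by case: (q.1.1) (r.1.1) => [[? ?] ?] [[? ?] ?] /= -> -> ->.
case: q r E Eu => [[u a] m] [[v b] n] /= E uv; move: E; rewrite uv /frame_map /=.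
by rewrite -!twr => /loop_mulgI/twist_cp_inj[-> ->].
Qed.

Lemma model_iso_of_frame : #|Q| = (16 * p)%N -> isomorphic_loops (model p P) Q.
Proof.
move=> cardQ.
pose frame_mapM := isMultiplicative.Build _ _ frame_map frame_map_mul.
exists (Multiplicative.Pack (Multiplicative.Class frame_mapM)).
apply: (inj_card_bij frame_map_inj).
by rewrite (card_model P p_pr) cardQ.
Qed.

End Frame.

(** * Normal forms and isomorphisms between models *)

(** One representative for each orbit: first the five odd sets of points of the Fano
    plane with zero linear form (a point, three independent points, five points, a
    line, the whole plane), then the eleven classes of pairs of such a set and a
    nonzero linear form. *)
Definition normal_forms : seq invariants := [::
  Invariants false false false false false false false;
  Invariants false false true  false false false false;
  Invariants false false true  true  false false false;
  Invariants false false false true  true  true  false;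
  Invariants true  true  true  true  true  true  false;
  Invariants false false false false false false true ;
  Invariants false false false false false true  true ;
  Invariants false false true  false false false true ;
  Invariants true  false false false false false true ;
  Invariants false false false false true  true  true ;
  Invariants false false true  true  false false true ;
  Invariants true  false false false false true  true ;
  Invariants false false false true  true  true  true ;
  Invariants false true  true  false false true  true ;
  Invariants false true  true  true  true  true  true ;
  Invariants true  true  true  true  true  true  true ].

Definition axis1 : vec := (true, false, false).
Definition axis2 : vec := (false, true, false).
Definition axis3 : vec := (false, false, true).

Definition exb (F : bool -> bool) := if F true then true else F false.

Lemma exbP F : exb F -> exists b, F b.
Proof. by rewrite /exb; case: ifP => [?|_ ?]; [exists true|exists false]. Qed.

Definition exv (F : vec -> bool) :=
  exb (fun a => exb (fun b => exb (fun c => F (a, b, c)))).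

Lemma exvP F : exv F -> exists u, F u.
Proof. by case/exbP=> a /exbP[b /exbP[c Fu]]; exists (a, b, c). Qed.

(** The vectors [x], [y], [z] lift to a frame with invariants [P'] in the model with
    invariants [P]; see [model_frame]. *)
Definition adapted (P P' : invariants) (x y z : vec) : bool :=
  [&& detv x y z,
      [&& cocycle P x x == sq1 P', cocycle P y y == sq2 P' & cocycle P z z == sq3 P'],
      [&& cocycle P y x == cocycle P x y (+) cm12 P',
          cocycle P z x == cocycle P x z (+) cm13 P'
        & cocycle P z y == cocycle P y z (+) cm23 P']
    & [&& inverts P x == dih P', ~~ inverts P y & ~~ inverts P z]].

Lemma normal_form_exists P : exists2 i, (i < 16)%N &
  exists x y z, adapted P (nth P normal_forms i) x y z.
Proof.
(* Testing the determinant first keeps the search short. *)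
have H : alli (fun P => has (fun P' => exv (fun x => exv (fun y => exv (fun z =>
    if detv x y z then adapted P P' x y z else false)))) normal_forms).
  by vm_compute.
move/alliP: H => /(_ P) H; exists (find (fun P' => exv (fun x => exv (fun y =>
  exv (fun z => if detv x y z then adapted P P' x y z else false)))) normal_forms).
  by rewrite has_find in H.
have /exvP[x /exvP[y /exvP[z]]] := nth_find P H.
by case: ifP => // _ A; exists x, y, z.
Qed.

Definition scalev (b : bool) (u : vec) : vec := if b then u else (false, false, false).
Definition combv (x y z u : vec) : vec :=
  addv (addv (scalev u.1.1 x) (scalev u.1.2 y)) (scalev u.2 z).

(** The diagonal of the cocycle is the squaring form.  Pulling back the squaring form
    and the sign of the second model along the linear map that sends the standard
    basis to [x], [y], [z] gives those of the first. *)
Definition similar (P P' : invariants) (x y z : vec) : bool :=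
  allv (fun u => (cocycle P' (combv x y z u) (combv x y z u) == cocycle P u u) &&
                 (inverts P' (combv x y z u) == inverts P u)).

Lemma normal_forms_distinct P0 i j x y z : (i < 16)%N -> (j < 16)%N ->
  similar (nth P0 normal_forms i) (nth P0 normal_forms j) x y z -> i = j.
Proof.
have H : all (fun i => all (fun j => allv (fun x => allv (fun y => allv (fun z =>
    similar (nth (nth P0 normal_forms 0) normal_forms i)
            (nth (nth P0 normal_forms 0) normal_forms j) x y z ==>
    (i == j))))) (iota 0 16)) (iota 0 16).
  by vm_compute.
move=> i16 j16.
have mem k : (k < 16)%N -> k \in iota 0 16 by rewrite mem_iota.
move/allP: H => /(_ i (mem i i16))/allP/(_ j (mem j j16)).
move/allvP/(_ x)/allvP/(_ y)/allvP/(_ z)/implyP => H S; apply/eqP/H.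
by rewrite (set_nth_default P0) ?(set_nth_default P0 (nth P0 normal_forms 0)).
Qed.

Section LoopIsomorphisms.

Lemma isomorphic_loops_sym (G H : loopType) :
  isomorphic_loops G H -> isomorphic_loops H G.
Proof.
case=> f [g gK Kg].
have gM : {morph g : x y / x * y}.
  by move=> x y; apply: (can_inj gK); rewrite gmulfM !Kg.
exists (Multiplicative.Pack (Multiplicative.Class (isMultiplicative.Build _ _ g gM))).
by exists f.
Qed.

Lemma isomorphic_loops_trans (G H K : loopType) :
  isomorphic_loops G H -> isomorphic_loops H K -> isomorphic_loops G K.
Proof.
case=> f bf [g bg]; exists (g \o f : {multiplicative G -> K}).
exact: bij_comp bg bf.
Qed.

End LoopIsomorphisms.

Section ModelIsomorphisms.

Variable p : nat.
Hypotheses (p_pr : prime p) (p_odd : odd p).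

Lemma model_ai P : associator_involution (model_e p P).
Proof.
split; first exact: (model_e_nucl p P true).
- exact: model_e_central.
- exact: model_e_sq.
- by move=> E; have := congr1 (fun q : model p P => q.1.2) E.
- exact: model_asc.
Qed.

Lemma model_split_center P : split_center (model_e p P) (@model_c p P).
Proof.
split; first exact: model_ai.
- by move=> m; apply: model_nucl.
- exact: model_cD.
- exact: model_c_inj.
Qed.

Lemma model_frame P P' x y z : adapted P P' x y z ->
  frame (model_e p P) (@model_c p P) P' (model_v p P x) (model_v p P y) (model_v p P z).
Proof.
move=> /and4P[D /and3P[/eqP s1 /eqP s2 /eqP s3] /and3P[/eqP t1 /eqP t2 /eqP t3]
  /and3P[/eqP d1 d2 d3]].
have addvv u : addv u u = (false, false, false) by rewrite /addv !addbb.
split.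
- move=> E; have := model_assoc (model_v p P x) (model_v p P y) (model_v p P z).
  by rewrite D -(mul_inner (@extra_model p P)) E -[LHS]mulg1 => /loop_mulgI.
- by rewrite model_v_mul s1 model_eE addvv.
- by rewrite model_v_mul s2 model_eE addvv.
- by rewrite model_v_mul s3 model_eE addvv.
- by rewrite !model_v_mul t1 model_e_mul addvC.
- by rewrite !model_v_mul t2 model_e_mul addvC.
- by rewrite !model_v_mul t3 model_e_mul addvC.
- by move=> m; rewrite model_c_comm d1.
- by move=> m; rewrite model_c_comm (negPf d2).
- by move=> m; rewrite model_c_comm (negPf d3).
Qed.

Lemma model_normal_form P : exists2 i, (i < 16)%N &
  isomorphic_loops (model p P) (model p (nth P normal_forms i)).
Proof.
have [i i16 [x [y [z A]]]] := normal_form_exists P; exists i => //.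
apply: isomorphic_loops_sym.
apply: (model_iso_of_frame (@extra_model p P) p_pr p_odd (model_split_center P)
  (model_frame A)).
exact: card_model.
Qed.

Lemma sgnz_fix b (m : 'Z_p) : m <> 0%R -> sgnz b m = m -> b = false.
Proof.
case: b => //= m0 E; case: m0; apply: (Zp_double_eq0 p_pr p_odd).
by rewrite -{1}E GRing.addNr.
Qed.

(** An isomorphism maps the involution [model_e] to its counterpart, since both are
    the nontrivial associator.  Hence it induces an additive map [h] on [vec] which
    respects squares.  A fourth power in ['Z_p] has no other component, so its image
    lies in ['Z_p] as well, and commuting with it is preserved. *)
Lemma model_iso_similar P P' : isomorphic_loops (model p P) (model p P') ->
  exists x y z, similar P P' x y z.
Proof.
case=> f bf; have f_inj := bij_inj bf.
have f1 : f 1 = 1 by apply: (@loop_mulgI _ (f 1)); rewrite -gmulfM !mulg1.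
have fe : f (model_e p P) = model_e p P'.
  have := congr1 f (model_assoc (model_v p P axis1) (model_v p P axis2)
    (model_v p P axis3)).
  rewrite !gmulfM model_assoc => /loop_mulgI.
  case: detv => //= E; suff : model_e p P = 1 by [].
  by apply: f_inj; rewrite f1 -E.
have fbe b : f (bpow (model_e p P) b) = bpow (model_e p P') b by case: b.
pose h u := (f (model_v p P u)).1.1.
have hD u v : h (addv u v) = addv (h u) (h v).
  have E : model_v p P u * model_v p P v =
      model_v p P (addv u v) * bpow (model_e p P) (cocycle P u v).
    by rewrite model_v_mul model_e_mul.
  have := congr1 (fun q => (f q).1.1) E; rewrite !gmulfM fbe model_e_mul /=.
  by rewrite /h => <-.
have hsq u : cocycle P' (h u) (h u) = cocycle P u u.
  have E : model_v p P u * model_v p P u = bpow (model_e p P) (cocycle P u u).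
    by rewrite model_v_mul model_eE /addv !addbb.
  have := congr1 (fun q => (f q).1.2) E; rewrite gmulfM fbe model_eE /= addbb.
  by [].
(* [c] is a fourth power of a generator of the cyclic part; as [p] is odd, it is a
   generator too. *)
pose d := model_c P (1%R : 'Z_p).
pose c := (d * d) * (d * d).
have cE : c = @model_c p P ((1 + 1) + (1 + 1))%R by rewrite /c /d -!model_cD.
have four_neq0 : ((1 + 1) + (1 + 1) <> 0 :> 'Z_p)%R.
  move=> /(Zp_double_eq0 p_pr p_odd)/(Zp_double_eq0 p_pr p_odd)/eqP.
  by rewrite GRing.oner_eq0.
have [m0 fc] : exists m0, f c = model_c P' m0.
  rewrite /c !gmulfM; case: (f d) => [[u a] m]; eexists.
  rewrite !model_mulE; rewrite /addv !addbb /= cocycle0r; reflexivity.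
have m0_neq0 : m0 <> 0%R.
  move=> m00; apply: four_neq0; apply: (@model_c_inj p P).
  by apply: f_inj; rewrite -cE fc m00 -[model_c P 0%R]/(1 : model p P) f1.
have hinv u : inverts P' (h u) = inverts P u.
  set four := (1 + 1 + (1 + 1))%R in cE four_neq0.
  have : f (model_v p P u) * f (model_c P (sgnz (inverts P u) four)) =
         f (model_v p P u) * model_c P' (sgnz (inverts P' (h u)) m0).
    by rewrite -gmulfM -(model_c_comm (model_v p P u)) -cE gmulfM fc model_c_comm.
  move/loop_mulgI; case: (inverts P u); last first.
    by rewrite /= -cE fc => /model_c_inj/esym; apply: sgnz_fix.
  case: (inverts P' (h u)) => //=; rewrite -fc cE => /f_inj/model_c_inj.
  by move/(@sgnz_fix true _ four_neq0).
exists (h axis1), (h axis2), (h axis3).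
suff hE u : combv (h axis1) (h axis2) (h axis3) u = h u.
  by rewrite /similar /allv /allb !hE !hsq !hinv !eqxx.
have h0 : h (false, false, false) = (false, false, false).
  by rewrite /h -[model_v _ _ _]/(1 : model p P) f1.
have scale b v : scalev b (h v) = h (scalev b v) by case: b; rewrite /= ?h0.
rewrite /combv !scale -!hD; congr h.
by case: u => [[[] []] []].
Qed.

End ModelIsomorphisms.

(** * The index of the nucleus *)

Section Nucleus.

Variable Q : finLoopType.
Hypothesis exQ : extra_loop Q.
Implicit Types x y z g n m : Q.

Definition nucleus : {set Q} :=
  [set n | [forall y, forall z, (y * z) * n == y * (z * n)]].

Lemma nucleusP n : reflect (nucl n) (n \in nucleus).
Proof.
rewrite inE; apply: (iffP 'forall_forallP) => [H | [_ _ R] y z].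
  by apply: (nuclR exQ) => y z; apply/eqP/H.
by rewrite R.
Qed.

(** These are the subloops that contain the nucleus.  Closure under division is
    automatic, because [x^-1] differs from [x] by a nuclear element. *)
Definition nucl_closed (H : {set Q}) :=
  nucleus \subset H /\ {in H &, forall x y, x * y \in H}.

Lemma nucl_closed_nuceq H x y : nucl_closed H -> nuceq x y -> x \in H -> y \in H.
Proof.
case=> NH Hm [n Nn ->] xH; apply: Hm => //; apply: (subsetP NH).
exact/nucleusP.
Qed.

Lemma nucl_closed_divl H x y : nucl_closed H -> x \in H -> x * y \in H -> y \in H.
Proof.
move=> oH xH xyH; apply: (nucl_closed_nuceq oH (nuceq_sql exQ x y)).
by have [_ ->] := oH.
Qed.

(** The quotient by the nucleus has exponent two, so one more generator doubles the
    size. *)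
Lemma nucl_closed_double H g : nucl_closed H -> g \notin H ->
  nucl_closed (H :|: [set g * h | h in H]) /\
  #|H :|: [set g * h | h in H]| = (2 * #|H|)%N.
Proof.
move=> oH gH; have [NH Hm] := oH; split; last first.
  rewrite cardsU card_imset; last by move=> a b /loop_mulgI.
  rewrite (_ : _ :&: _ = set0) ?cards0 ?subn0 ?mul2n ?addnn //.
  apply/setP=> h; rewrite !inE; apply/negP => /andP[hH /imsetP[k kH E]].
  case/negP: gH; apply: (nucl_closed_divl oH kH).
  by apply: (nucl_closed_nuceq oH (nuceq_comm exQ g k)); rewrite -E.
split; first exact: subset_trans NH (subsetUl _ _).
have up h h' : h \in H -> nuceq h h' -> h' \in H :|: [set g * h | h in H].
  by move=> hH E; rewrite inE (nucl_closed_nuceq oH E hH).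
have gup h h' : h \in H -> nuceq (g * h) h' -> h' \in H :|: [set g * h | h in H].
  move=> hH [n Nn ->]; rewrite inE; apply/orP; right; apply/imsetP.
  exists (h * n); first by apply: Hm => //; apply/(subsetP NH)/nucleusP.
  by have [_ _ ->] := Nn.
move=> a b /setUP[aH | /imsetP[a' aH ->]] /setUP[bH | /imsetP[b' bH ->]].
- by rewrite inE Hm.
- apply: (gup (a * b')); first exact: Hm.
  apply: (nuceq_trans exQ (nuceq_sym exQ (nuceq_assoc exQ _ _ _))).
  apply: (nuceq_trans exQ (nuceq_mul exQ (nuceq_comm exQ g a) (nuceq_refl b'))).
  exact: nuceq_assoc.
- apply: (gup (a' * b)); first exact: Hm.
  exact: nuceq_sym (nuceq_assoc _ _ _ _).
- apply: (up (a' * b')); first exact: Hm.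
  apply: (nuceq_sym exQ); apply: (nuceq_trans exQ (nuceq_assoc exQ _ _ _)).
  have congr_g := nuceq_mul exQ (nuceq_refl g).
  apply: (nuceq_trans exQ (congr_g _ _ (nuceq_sym exQ (nuceq_assoc exQ _ _ _)))).
  have a'g := nuceq_mul exQ (nuceq_comm exQ a' g) (nuceq_refl b').
  apply: (nuceq_trans exQ (congr_g _ _ a'g)).
  apply: (nuceq_trans exQ (congr_g _ _ (nuceq_assoc exQ _ _ _))).
  exact: nuceq_sql.
Qed.

Lemma nucl_closed_index H K : nucl_closed H -> nucl_closed K -> H \subset K ->
  exists k, #|K| = (2 ^ k * #|H|)%N.
Proof.
move=> oH oK; have [d le_d] := ubnP (#|K| - #|H|); elim: d => // d IHd in H oH le_d *.
move=> sHK; case: (set_0Vmem (K :\: H)) => [/eqP|[g]].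
  rewrite setD_eq0 => sKH; exists 0; rewrite mul1n.
  by have /eqP-> : K == H by rewrite eqEsubset sKH sHK.
rewrite inE => /andP[gH gK]; have [oH' cH'] := nucl_closed_double oH gH.
have H_gt0 : (0 < #|H|)%N.
  have [NH _] := oH; rewrite card_gt0; apply/set0Pn; exists 1.
  by apply: (subsetP NH); apply/nucleusP; apply: nucl1.
have sH'K : H :|: [set g * h | h in H] \subset K.
  rewrite subUset sHK; apply/subsetP=> _ /imsetP[h hH ->].
  by have [_ Km] := oK; apply: Km => //; apply: (subsetP sHK).
have lt_d : #|K| - #|H :|: [set g * h | h in H]| < d.
  have := subset_leq_card sH'K; rewrite cH' => le; move: le_d.
  rewrite ltnS => /(leq_trans _)->//; rewrite ltn_sub2l //; last by rewrite ltn_Pmull.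
  by apply: leq_trans le; rewrite ltn_Pmull.
have [k ->] := IHd _ oH' lt_d sH'K; exists k.+1.
by rewrite cH' expnSr mulnA.
Qed.

Lemma nucl_closed_index_proper H K : nucl_closed H -> nucl_closed K -> H \proper K ->
  exists k, #|K| = (2 ^ k.+1 * #|H|)%N.
Proof.
move=> oH oK pHK; have [[|k] E] := nucl_closed_index oH oK (proper_sub pHK).
  by move: (proper_card pHK); rewrite E mul1n ltnn.
by exists k.
Qed.

Definition inner_fix x y : {set Q} := [set t | inner x y t == t].

Lemma nucl_closed_fix x y : nucl_closed (inner_fix x y).
Proof.
split=> [|a b]; last by rewrite !inE (inner_mul exQ) => /eqP-> /eqP->.
by apply/subsetP=> n /nucleusP Nn; rewrite inE inner_nucl.
Qed.

Lemma nucl_closedI H K : nucl_closed H -> nucl_closed K -> nucl_closed (H :&: K).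
Proof.
move=> [NH Hm] [NK Km]; split; first by rewrite subsetI NH.
by move=> a b /setIP[aH aK] /setIP[bH bK]; rewrite inE Hm ?Km.
Qed.

Lemma nucl_closed_nucleus : nucl_closed nucleus.
Proof.
split=> // a b /nucleusP Na /nucleusP Nb.
by apply/nucleusP; apply: nucl_mul.
Qed.

Lemma nucl_closedT : nucl_closed [set: Q].
Proof. by split=> [|x y]; rewrite ?subsetT ?inE. Qed.

Lemma inner_perm x y z : inner x z y = y -> inner x y z = z.
Proof.
move=> E; apply: (@loop_mulgI _ (x * y)); rewrite (mul_inner exQ) (mulA_mid exQ).
by rewrite E.
Qed.

(** The elements fixed by [inner x y], by [inner x z] and by [inner y z] form subloops
    above the nucleus.  Intersecting them one after another excludes [z], then [y],
    then [x], so that each step contributes a factor of two. *)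
Lemma nucleus_index x y z : inner x y z <> z ->
  exists k, #|Q| = (2 ^ k.+3 * #|nucleus|)%N.
Proof.
move=> xyz.
have xzy : inner x z y <> y by move/inner_perm.
have yzx : inner y z x <> x.
  by rewrite (inner_sym exQ) => /inner_perm; rewrite (inner_sym exQ) => /inner_perm/xyz.
pose A := inner_fix x y; pose B := A :&: inner_fix x z; pose C := B :&: inner_fix y z.
have oA := nucl_closed_fix x y; have oB := nucl_closedI oA (nucl_closed_fix x z).
have oC := nucl_closedI oB (nucl_closed_fix y z).
have pAQ : A \proper [set: Q].
  by rewrite properT; apply/eqP=> /setP/(_ z); rewrite !inE => /eqP.
have pBA : B \proper A.
  apply/properP; split; first exact: subsetIl.
  by exists y; rewrite !inE (inner_fixr exQ) eqxx //=; apply/eqP.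
have pCB : C \proper B.
  apply/properP; split; first exact: subsetIl.
  by exists x; rewrite !inE !(inner_fixl exQ) !eqxx //=; apply/eqP.
have sNC : nucleus \subset C by case: oC.
have [k1 E1] := nucl_closed_index_proper oA nucl_closedT pAQ.
have [k2 E2] := nucl_closed_index_proper oB oA pBA.
have [k3 E3] := nucl_closed_index_proper oC oB pCB.
have [k4 E4] := nucl_closed_index nucl_closed_nucleus oC sNC.
exists (k1 + k2 + k3 + k4)%N; rewrite -cardsT E1 E2 E3 E4 !mulnA -!expnD.
by congr (2 ^ _ * _)%N; rewrite !(addSn, addnS).
Qed.

End Nucleus.

(** * The nucleus as a finite group *)

Section NucleusGroup.

Variable Q : finLoopType.
Hypothesis exQ : extra_loop Q.

(** The type depends on the proof that the loop is extra, because the group structure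
    does. *)
Definition nucleus_group of extra_loop Q := {n : Q | n \in nucleus Q}.
Local Notation N := (nucleus_group exQ).

HB.instance Definition _ := SubFinite.copy N {n : Q | n \in nucleus Q}.

Lemma nucleus_mem (n : N) : nucl (val n).
Proof. exact/nucleusP/valP. Qed.

Definition nucleus_mul (n m : N) : N :=
  Sub (val n * val m)
    (introT (nucleusP exQ _) (nucl_mul exQ (nucleus_mem n) (nucleus_mem m))).
Definition nucleus_one : N := Sub 1 (introT (nucleusP exQ _) (nucl1 Q)).
Definition nucleus_inv (n : N) : N :=
  Sub (val n)^-1 (introT (nucleusP exQ _) (nuclV exQ (nucleus_mem n))).

Lemma nucleus_mulA : associative nucleus_mul.
Proof.
move=> n m k; apply: val_inj => /=.
by have [-> _ _] := nucleus_mem n.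
Qed.

Lemma nucleus_mul1 : left_id nucleus_one nucleus_mul.
Proof. by move=> n; apply: val_inj; rewrite /= mul1g. Qed.

Lemma nucleus_mulV : left_inverse nucleus_one nucleus_inv nucleus_mul.
Proof. by move=> n; apply: val_inj; rewrite /= loop_mulVg. Qed.

HB.instance Definition _ :=
  Finite_isGroup.Build N nucleus_mulA nucleus_mul1 nucleus_mulV.

Lemma val_nucleus_mul (n m : N) : val (n * m) = val n * val m.
Proof. by []. Qed.

Lemma card_nucleus_group : #|{: N}| = #|nucleus Q|.
Proof. by rewrite card_sig. Qed.

End NucleusGroup.

(** * Nonassociative extra loops of order 16p *)

Section Order16p.

Variables (Q : finLoopType) (p : nat).
Hypothesis exQ : extra_loop Q.
Hypothesis p_pr : prime p.
Hypothesis p_odd : odd p.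
Hypothesis nonassocQ : nonassociative Q.
Hypothesis cardQ : #|Q| = (16 * p)%N.
Implicit Types x y z g : Q.
Local Notation N := (nucleus_group exQ).

Lemma nonassoc_inner : exists x y z : Q, inner x y z <> z.
Proof.
have [/existsP[[[x y] z] /eqP H]|H] :=
  boolP [exists t : Q * Q * Q, inner t.1.1 t.1.2 t.2 != t.2].
  by exists x, y, z.
case: nonassocQ => x y z; rewrite -(mul_inner exQ); congr (_ * _).
by move: H; rewrite negb_exists => /forallP/(_ (x, y, z)); rewrite negbK => /eqP.
Qed.

Lemma nucleus_involution x y z : inner x y z <> z ->
  exists2 a : N, val a = asc x y z & #[a] = 2.
Proof.
move=> xyz; have Na := asc_nucl exQ x y z.
pose a : N := Sub (asc x y z) (introT (nucleusP exQ _) Na); exists a => //.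
apply: nt_prime_order => //.
  by rewrite expg2; apply: val_inj; rewrite val_nucleus_mul /= asc_sq.
apply/eqP=> /(congr1 val) /= E; apply: xyz.
by rewrite (innerE exQ) E mulg1.
Qed.

(** The index is at least 8 and a power of two, the order of the nucleus is even, and
    [p] is odd. *)
Lemma card_nucleus : #|{: N}| = (2 * p)%N.
Proof.
have [x [y [z xyz]]] := nonassoc_inner.
have [k E] := nucleus_index exQ xyz.
have [a _ oa] := nucleus_involution xyz.
have /dvdnP[m Em] : 2 %| #|{: N}| by rewrite -oa -cardsT order_dvdG ?inE.
move: E; rewrite cardQ -(card_nucleus_group exQ) Em.
have -> : (2 ^ k.+3 * (m * 2) = 16 * (2 ^ k * m))%N.
  by rewrite -addn3 expnD mulnACA mulnC.
move/eqP; rewrite eqn_pmul2l // => /eqP E.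
case: k E => [|k] E; first by rewrite E mul1n mulnC.
by move: p_odd; rewrite E expnS -mulnA oddM.
Qed.

Record nucleus_basis (a c : N) : Prop := NucleusBasis {
  nb_a : #[a] = 2;
  nb_c : #[c] = p;
  nb_central : forall n : N, a * n = n * a;
  nb_gen : forall n : N, exists i j, n = a ^+ i * c ^+ j;
  nb_asc : exists x y z, inner x y z <> z }.

(** An associator generates a central subgroup of order two of the nucleus, and by
    Cauchy's theorem there is a subgroup of order [p]; by orders, their product is the
    nucleus. *)
Lemma nucleus_basis_exists : exists a c : N, nucleus_basis a c.
Proof.
have [x [y [z xyz]]] := nonassoc_inner.
have [a Ea oa] := nucleus_involution xyz.
have [|c _ oc] := @Cauchy _ p [set: N]%G p_pr.
  by rewrite cardsT card_nucleus dvdn_mull.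
have ca n : a * n = n * a.
  by apply: val_inj; rewrite !val_nucleus_mul Ea asc_comm_nucl //; apply: nucleus_mem.
exists a, c; split=> //; last by exists x, y, z.
have genT : <[a]> * <[c]> = [set: N].
  have co : coprime #|<[a]>| #|<[c]>| by rewrite -!orderE oa oc coprime2n.
  apply/eqP; rewrite eqEcard subsetT cardsT card_nucleus coprime_cardMg //.
  by rewrite -!orderE oa oc leqnn.
move=> n; have : n \in <[a]> * <[c]> by rewrite genT inE.
by case/mulsgP=> _ _ /cycleP[i ->] /cycleP[j ->] ->; exists i, j.
Qed.

Section SplitNucleus.

Variables a c : N.
Hypothesis nb : nucleus_basis a c.

Lemma expa2 : a ^+ 2 = 1.
Proof. by rewrite -(nb_a nb) expg_order. Qed.

Lemma nucleus_comm (n m : N) : n * m = m * n.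
Proof.
have [i [j ->]] := nb_gen nb n; have [k [l ->]] := nb_gen nb m.
have ca r s : commute r (a ^+ s).
  by apply: commuteX; apply: commute_sym; apply: (nb_central nb).
apply: commuteM; first exact: ca.
apply: commute_sym; apply: commuteM; first exact: ca.
by apply: commuteX2; apply: commute_refl.
Qed.

Lemma nucleus_sq (b : N) : b * b = 1 -> b = 1 \/ b = a.
Proof.
have [i [j ->]] := nb_gen nb b.
rewrite -mulgA (nucleus_comm (c ^+ j)) !mulgA -expgD -mulgA -expgD !addnn -!mul2n.
rewrite (expgM a) expa2 expg1n mul1g => /eqP.
rewrite -order_dvdn (nb_c nb) Gauss_dvdr ?coprimen2 // => pj.
have -> : c ^+ j = 1 by apply/eqP; rewrite -order_dvdn (nb_c nb).
rewrite mulg1 -(odd_double_half i) expgD -mul2n expgM expa2 expg1n mulg1.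
by case: (odd i); [right | left].
Qed.

Lemma val_involution x : nucl x -> x * x = 1 -> x = 1 \/ x = val a.
Proof.
move=> Nx xx; pose n : N := Sub x (introT (nucleusP exQ _) Nx).
have : n * n = 1 by apply: val_inj; rewrite val_nucleus_mul.
by case/nucleus_sq=> /(congr1 val); [left | right].
Qed.

(** Conjugates of [a] and associators are nuclear and of square one, and [a] is the
    only involution of the nucleus. *)
Lemma nucleus_ai : associator_involution (val a).
Proof.
have a_neq1 : val a <> 1.
  move=> E; have a1 : a = 1 by apply: val_inj.
  by have := nb_a nb; rewrite a1 order1.
have a_sq : val a * val a = 1 by rewrite -val_nucleus_mul -expg2 expa2.
split=> //; first exact: nucleus_mem.
- move=> x; have Na := nucleus_mem a.
  have sq1 : conjl x (val a) * conjl x (val a) = 1.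
    by rewrite (conjl_sq exQ) a_sq /conjl mulg1 loopV_rinv.
  case: (val_involution (nucl_conj exQ x Na) sq1) => E.
    case: a_neq1; rewrite -(conjlK exQ x (val a)) E /conjl mulg1.
    by rewrite loopV_rinv.
  by rewrite -{1}E conjlM.
- by move=> x y z; apply: val_involution; [apply: asc_nucl | apply: asc_sq].
Qed.

Definition cpow (m : 'Z_p) : Q := val (c ^+ m).

Lemma cpow_split_center : split_center (val a) cpow.
Proof.
have pE : (Zp_trunc p).+2 = p by apply: Zp_cast; apply: prime_gt1.
split; first exact: nucleus_ai.
- by move=> m; apply: nucleus_mem.
- move=> m n; rewrite /cpow -val_nucleus_mul -expgD; congr val.
  apply/eqP; rewrite eq_expg_mod_order (nb_c nb) /=.
  have -> : (m + n) %% (Zp_trunc p).+2 = (m + n) %% p by congr (_ %% _).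
  by rewrite modn_mod.
- move=> m n /val_inj/eqP; rewrite eq_expg_mod_order (nb_c nb).
  rewrite !modn_small => [/eqP||]; first exact: val_inj.
  by apply: leq_trans (ltn_ord n) _; rewrite pE.
  by apply: leq_trans (ltn_ord m) _; rewrite pE.
Qed.

Local Notation e := (val a).

Lemma cpowE k : val (c ^+ k) = cpow (inZp k).
Proof.
congr val; apply/eqP; rewrite eq_expg_mod_order (nb_c nb) /=.
have -> : k %% (Zp_trunc p).+2 = k %% p.
  by congr (_ %% _); apply: Zp_cast; apply: prime_gt1.
by rewrite modn_mod.
Qed.

Definition inverted_by x b := forall m, cpow m * x = x * cpow (sgnz b m).

Definition nconj x (n : N) : N :=
  Sub (conjl x (val n)) (introT (nucleusP exQ _) (nucl_conj exQ x (nucleus_mem n))).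

Lemma nconjM x : {morph nconj x : n m / n * m}.
Proof.
by move=> n m; apply: val_inj; apply: conjl_mul => //; apply: nucleus_mem.
Qed.

Lemma nconj1 x : nconj x 1 = 1.
Proof. by apply: val_inj; rewrite /= /conjl mulg1 loopV_rinv. Qed.

Lemma nconjX x n k : nconj x (n ^+ k) = nconj x n ^+ k.
Proof.
by elim: k => [|k IHk]; rewrite ?expg0 ?nconj1 // !expgS nconjM IHk.
Qed.

(** Conjugating twice by [x] is conjugating by [x * x], which lies in the abelian
    group [N]. *)
Lemma nconjK x : involutive (nconj x).
Proof.
move=> n; have Nn := nucleus_mem n; apply: val_inj => /=.
rewrite conjl_conjl //.
pose s : N := Sub (x * x) (introT (nucleusP exQ _) (nucl_sq exQ x)).
have := nucleus_comm s n => /(congr1 val); rewrite !val_nucleus_mul /= /conjl => ->.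
by rewrite loop_mulgK.
Qed.

(** The element [c] is a square [d ^+ 2], and squares in the nucleus are powers of
    [c]. *)
Lemma nconj_c x : exists k, nconj x c = c ^+ k.
Proof.
pose d := c ^+ uphalf p.
have d2 : d ^+ 2 = c.
  rewrite -expgM muln2 uphalf_half p_odd add1n doubleS.
  have := odd_double_half p; rewrite p_odd add1n => pE.
  by rewrite pE expgSr -(nb_c nb) expg_order mul1g.
have [i [j E]] := nb_gen nb (nconj x d).
exists (j * 2)%N; rewrite -{1}d2 nconjX E expgMn; last exact: nucleus_comm.
by rewrite -[(a ^+ i) ^+ 2]expgM (mulnC i) expgM expa2 expg1n mul1g expgM.
Qed.

(** Conjugation maps [c] to [c ^+ k] with [k * k = 1] modulo [p], by [nconjK]. *)
Lemma conj_cpow x : exists b, forall m, conjl x (cpow m) = cpow (sgnz b m).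
Proof.
have [k Ek] := nconj_c x.
have kk : k * k == 1 %[mod p].
  rewrite -(nb_c nb) -eq_expg_mod_order expg1 expgM -Ek -nconjX -Ek.
  by rewrite nconjK.
have k_gt0 : 0 < k.
  by case: (k) kk => //; rewrite mod0n modn_small ?prime_gt1.
have : p %| (k - 1) * (k + 1).
  by rewrite -subn_sqr exp1n -eqn_mod_dvd ?expn_gt0 ?k_gt0 // -mulnn.
rewrite Euclid_dvdM // => /orP[] pk.
  exists false => m /=; have -> : conjl x (cpow m) = val (nconj x (c ^+ m)) by [].
  rewrite nconjX (_ : nconj x c = c) // Ek -[RHS]expg1; apply/eqP.
  by rewrite eq_expg_mod_order (nb_c nb) eqn_mod_dvd.
exists true => m /=; apply: (@loop_mulgI _ (cpow m)).
rewrite -(sc_cpD cpow_split_center) GRing.addrN (cp0 cpow_split_center).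
have -> : cpow m * conjl x (cpow m) = val (c ^+ m * nconj x (c ^+ m)) by [].
rewrite nconjX Ek -expgM -expgD -mulSn.
have -> : c ^+ (k.+1 * m) = 1; last by [].
rewrite addn1 in pk; by apply/eqP; rewrite -order_dvdn (nb_c nb) dvdn_mulr.
Qed.

Lemma inverted_by_exists x : exists b, inverted_by x b.
Proof.
have [b E] := conj_cpow x^-1; exists b => m.
by rewrite -E (conjlE exQ) (loop_invgK exQ) (loop_mulKV exQ).
Qed.

Lemma inverted_byM x y b d : inverted_by x b -> inverted_by y d ->
  inverted_by (x * y) (b (+) d).
Proof.
move=> bx dy m; have [L _ _] := nucleus_mem (c ^+ m).
have [_ M R] := sc_cp_nucl cpow_split_center (sgnz b m).
have [_ _ R'] := sc_cp_nucl cpow_split_center (sgnz d (sgnz b m)).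
by rewrite -L bx M dy -R' sgnz_sgnz addbC.
Qed.

Lemma inverted_by_nucl n : nucl n -> inverted_by n false.
Proof.
move=> Nn m; pose s : N := Sub n (introT (nucleusP exQ _) Nn).
by have := congr1 val (nucleus_comm (c ^+ m) s).
Qed.

Lemma centralizes_nucleus y n : inverted_by y false -> nucl n -> n * y = y * n.
Proof.
move=> ay Nn; pose s : N := Sub n (introT (nucleusP exQ _) Nn).
have [i [j E]] := nb_gen nb s; have -> : n = val s by [].
have -> : val s = val (a ^+ i) * val (c ^+ j) by rewrite E.
have Na i' : val (a ^+ i') * y = y * val (a ^+ i').
  elim: i' => [|i' IH]; first by rewrite expg0 /= mul1g mulg1.
  have [L M _] := nucleus_mem a.
  by rewrite expgS val_nucleus_mul L IH -L (ai_central nucleus_ai) M.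
have Cy : val (c ^+ j) * y = y * val (c ^+ j) by rewrite cpowE; apply: ay.
have [L M _] := nucleus_mem (a ^+ i).
by rewrite L Cy -L Na M.
Qed.

Lemma sq_bpow n : nucl n -> n * n = 1 -> exists s, n = bpow e s.
Proof.
by move=> Nn /val_involution[//|->|->]; [exists false | exists true].
Qed.

Lemma sq_mul_nucl x n : nucl n -> n * x = x * n ->
  (x * n) * (x * n) = (x * x) * (n * n).
Proof.
move=> Nn nx; have [_ M R] := Nn; have [_ _ Rnn] := nucl_mul exQ Nn Nn.
by rewrite M -(R n) nx R Rnn.
Qed.

(** The square [s] of [x] commutes with [x] and has order dividing [2p].  Multiplying
    [x] by [s ^+ p./2] replaces the square by [s ^+ p]. *)
Lemma sq_adjust x : exists2 n, nucl n & exists s, (x * n) * (x * n) = bpow e s.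
Proof.
pose s : N := Sub (x * x) (introT (nucleusP exQ _) (nucl_sq exQ x)).
have sx k : val (s ^+ k) * x = x * val (s ^+ k).
  elim: k => [|k IHk]; first by rewrite expg0 /= mul1g mulg1.
  have [L M _] := nucleus_mem s.
  by rewrite expgS val_nucleus_mul L IHk -L (flexible exQ) M.
pose n := s ^+ p./2; exists (val n); first exact: nucleus_mem.
rewrite (sq_mul_nucl (nucleus_mem n) (sx _)).
have -> : x * x * (val n * val n) = val (s ^+ p).
  by rewrite -[in RHS](odd_double_half p) p_odd -addnn expgS expgD.
apply: sq_bpow; first exact: nucleus_mem.
rewrite -val_nucleus_mul -expg2 -expgM mulnC -card_nucleus.
have -> : s ^+ #|{: N}| = 1; last by [].
by apply/eqP; rewrite -order_dvdn -cardsT order_dvdG ?inE.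
Qed.

(** The conjugate [y n] of [y] has the same square as [y], because this square is
    central; since [n] commutes with [y], the square of [n] is one. *)
Lemma commutator_bpow g y s : inverted_by y false -> y * y = bpow e s ->
  exists t, g * y = (y * g) * bpow e t.
Proof.
move=> ay ys; have [n Nn E] := conjl_comm exQ g y.
have nn : n * n = 1.
  have := conjl_sq exQ g y; rewrite E (sq_mul_nucl Nn (centralizes_nucleus ay Nn)).
  have -> : conjl g (y * y) = y * y.
    apply: (@loop_mulIg _ g); rewrite (conjlM exQ) ys.
    by case: (s); rewrite /= ?mul1g ?mulg1 // (ai_central nucleus_ai).
  by rewrite -[RHS]mulg1 => /loop_mulgI.
have [t Et] := sq_bpow Nn nn; exists t.
have [_ M R] := Nn; rewrite -(conjlM exQ) E M -Et R; congr (_ * _); rewrite Et.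
by case: (t); rewrite /= ?mul1g ?mulg1 // (ai_central nucleus_ai).
Qed.

Lemma frame_triple : exists x y z b, [/\ inner x y z <> z,
  inverted_by x b, inverted_by y false & inverted_by z false].
Proof.
have ascbP x y z : reflect (inner x y z <> z) (ascb x y z).
  by apply: (iffP idP) => [/eqP|?] //; apply/eqP.
have sl := ascb_symml exQ; have sr := ascb_symmr exQ nucleus_ai.
have Dr := ascbDr exQ nucleus_ai.
have step x y z b : ascb x y z -> inverted_by x b ->
    b \/ inverted_by y false /\ inverted_by z false -> exists x y z b, [/\ inner x y z <> z,
      inverted_by x b, inverted_by y false & inverted_by z false].
  (* If [x] inverts, multiplying by [x] lets the other two centralize, and it does not
     change the associator with [x]. *)
  have fix1 u : inverted_by x true -> exists2 w, inverted_by w false &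
      forall v, ascb x v w = ascb x v u.
    move=> ix; have [[] iu] := inverted_by_exists u; last by exists u.
    exists (x * u) => [|v]; first exact: (inverted_byM ix iu).
    by rewrite Dr (ascb_lr exQ).
  move=> /ascbP xyz; case: b => [ix _|ix [//|[iy iz]]]; last by exists x, y, z, false.
  have [z' iz' Ez] := fix1 z ix; have [y' iy' Ey] := fix1 y ix.
  exists x, y', z', true; split=> //; apply/ascbP.
  by rewrite Ez sr Ey sr; apply/ascbP.
have [x [y [z /ascbP xyz]]] := nb_asc nb.
have [[] ix] := inverted_by_exists x; first by apply: (step x y z true) => //; left.
have [[] iy] := inverted_by_exists y.
  have yxz : ascb y x z by rewrite sl.
  by apply: (step y x z true) => //; left.
have [[] iz] := inverted_by_exists z.
  have zxy : ascb z x y by rewrite sl sr.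
  by apply: (step z x y true) => //; left.
by apply: (step x y z false) => //; right.
Qed.

(** The adjustments of [sq_adjust] multiply by nuclear elements, which changes neither
    associators nor the action on the nucleus. *)
Lemma frame_exists : exists P x y z, frame e cpow P x y z.
Proof.
have [x [y [z [b [xyz ix iy iz]]]]] := frame_triple.
have inv_adj u b' n : nucl n -> inverted_by u b' -> inverted_by (u * n) b'.
  move=> Nn iu; rewrite -[b']addbF.
  by apply: inverted_byM => //; apply: inverted_by_nucl.
have [n1 N1 [s1 E1]] := sq_adjust x.
have [n2 N2 [s2 E2]] := sq_adjust y.
have [n3 N3 [s3 E3]] := sq_adjust z.
have {}ix := inv_adj _ _ _ N1 ix; have {}iy := inv_adj _ _ _ N2 iy.
have {}iz := inv_adj _ _ _ N3 iz.
have {}xyz : inner (x * n1) (y * n2) (z * n3) <> z * n3.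
  rewrite inner_xn // inner_yn // inner_mul // (inner_nucl exQ _ _ N3) => /loop_mulIg.
  exact: xyz.
have [t1 C1] := commutator_bpow (x * n1) iy E2.
have [t2 C2] := commutator_bpow (x * n1) iz E3.
have [t3 C3] := commutator_bpow (y * n2) iz E3.
have flip u v t : u * v = (v * u) * bpow e t -> v * u = (u * v) * bpow e t.
  move=> ->; have [_ -> _] := bpow_e_nucl nucleus_ai t.
  by case: t; rewrite /= ?mulg1 // (ai_sq nucleus_ai) mulg1.
exists (Invariants s1 s2 s3 t1 t2 t3 b), (x * n1), (y * n2), (z * n3).
by split=> //=; try exact: flip.
Qed.

End SplitNucleus.

Theorem model_of_order16p : exists P, isomorphic_loops Q (model p P).
Proof.
have [a [c nb]] := nucleus_basis_exists.
have [P [x [y [z fr]]]] := frame_exists nb; exists P.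
apply: isomorphic_loops_sym.
exact: (model_iso_of_frame exQ p_pr p_odd (cpow_split_center nb) fr).
Qed.

End Order16p.

Theorem theorem8p6 (p : nat) (p_prime : prime p) (p_odd : odd p) :
  exists L : 'I_16 -> finLoopType,
    [/\ forall i : 'I_16,
          [/\ extra_loop (L i), nonassociative (L i) & #|L i| = (16 * p)%N],
        forall i j : 'I_16, isomorphic_loops (L i) (L j) -> i = j
      & forall G : finLoopType,
          extra_loop G -> nonassociative G -> #|G| = (16 * p)%N ->
          exists i : 'I_16, isomorphic_loops G (L i)].
Proof.
pose P0 := Invariants false false false false false false false.
exists (fun i : 'I_16 => model p (nth P0 normal_forms i)); split.
- move=> i; split; [exact: extra_model | exact: model_nonassoc | exact: card_model].
- move=> i j /(model_iso_similar p_prime p_odd)[x [y [z S]]].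
  by apply: val_inj; apply: normal_forms_distinct S.
- move=> G exG naG cG; have [P GP] := model_of_order16p exG p_prime p_odd naG cG.
  have [i i16 Pi] := model_normal_form p_prime p_odd P; exists (Ordinal i16).
  by rewrite (set_nth_default P) //; apply: isomorphic_loops_trans GP Pi.
Qed.
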